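(* Assume that $F$ and $G$ are differentiable in the sense of the context and satisfy the Lipschitz-derivative assumption of the context. Then the projected gradient algorithm described in the context terminates: for all inputs $m_{\mathrm{init}}\in\mathrm{cl}(\mathcal{R})$, $s_{\mathrm{init}}\in\mathbb{R}_{\ge0}^N$, $\lambda\in\mathbb{R}^N$, $c>0$, $\omega>0$, every run of the algorithm reaches, after finitely many iterations, an index $\ell$ with $\varepsilon_\ell\le\omega$.
   Context: Controlled SDE. Fix $T>0$ and a $d$-dimensional Brownian motion $(W_t)_{t\in[0,T]}$; $\mathcal{F}_{0,s}$ denotes the $\sigma$-algebra generated by $(W_\theta-W_0)_{\theta\in[0,s]}$. Let $U\subset\mathbb{R}^k$ be compact. Let $Y_0$ be an $\mathbb{R}^n$-valued random variable independent of $\mathcal{F}_{0,T}$. $\mathcal{U}_0(Y_0)$ is the set of (jointly measurable) control processes $(u_s)_{s\in[0,T]}$ with values in $U$ such that for all $s\in[0,T]$, $u_s$ is measurable with respect to the $\sigma$-algebra generated by $Y_0$ and $\mathcal{F}_{0,s}$. The drift $b:\mathbb{R}^n\times U\to\mathbb{R}^n$ and the volatility $\sigma:\mathbb{R}^n\times U\to\mathbb{R}^{n\times d}$ satisfy, for some $K>0$ and all $x,y\in\mathbb{R}^n$, $u,v\in U$: $|b(x,u)|+|\sigma(x,u)|\le K(1+|x|+|u|)$ and $|b(x,u)-b(y,v)|+|\sigma(x,u)-\sigma(y,v)|\le K(|y-x|+|v-u|)$. There is $p\ge 2$, fixed, such that the law of $Y_0$ has a finite $p$-th moment. For $u\in\mathcal{U}_0(Y_0)$,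 $(X_s^{0,Y_0,u})_{s\in[0,T]}$ is the solution to $\mathrm{d}X_s=b(X_s,u_s)\,\mathrm{d}s+\sigma(X_s,u_s)\,\mathrm{d}W_s$, $X_0=Y_0$, and $m_s^{0,Y_0,u}$ is the law of $X_s^{0,Y_0,u}$. $\mathcal{R}=\{m_T^{0,Y_0,u}\mid u\in\mathcal{U}_0(Y_0)\}$. Measures. $\mathcal{P}_q(\mathbb{R}^n)$ is the set of probability measures on $\mathbb{R}^n$ with finite $q$-th moment; $d_1$ is the Wasserstein distance on $\mathcal{P}_1(\mathbb{R}^n)$ associated with the cost $|y-x|$; $\mathrm{cl}$ is closure for $d_1$. $\bar{B}_p(R)=\{m\in\mathcal{P}_p(\mathbb{R}^n)\mid\int|x|^p\,\mathrm{d}m(x)\le R\}$. The constant $R>0$ is fixed such that $\mathcal{R}\subseteq\bar{B}_p(R)$ (such an $R$ exists). The set $\mathrm{cl}(\mathcal{R})$ is convex and $d_1$-compact. $\widehat{\mathcal{M}}_p(\mathbb{R}^n)$ is the vector space of finite signed measures $m$ on $\mathbb{R}^n$ with $\int|x|^p\,\mathrm{d}|m|(x)<\infty$ and $\int 1\,\mathrm{d}m=0$. A function $\phi:\mathbb{R}^n\to\mathbb{R}^q$ is dominated by $|x|^p$ if for all $\varepsilon>0$ there is $r>0$ with $|\phi(x)|\le\varepsilon|x|^p$ whenever $|x|\ge r$. A function $\phi$ is a representative of a linear map $A:\widehat{\mathcal{M}}_p(\mathbb{R}^n)\to\mathbb{R}^q$ if $Am=\int\phi\,\mathrm{d}m$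 (well defined) for all $m\in\widehat{\mathcal{M}}_p(\mathbb{R}^n)$. Standing assumptions on $F:\mathcal{P}_p(\mathbb{R}^n)\to\mathbb{R}$ and $G:\mathcal{P}_p(\mathbb{R}^n)\to\mathbb{R}^N$. (Continuity) The restrictions of $F$ and $G$ to $\bar{B}_p(R)$ are continuous for $d_1$. (Differentiability of $F$) For every $m\in\bar{B}_p(R)$ there is a linear form $DF(m):\widehat{\mathcal{M}}_p(\mathbb{R}^n)\to\mathbb{R}$ such that for all $m_1,m_2\in\bar{B}_p(R)$ and all $\varepsilon>0$ there are $\bar\xi,\bar\zeta\in(0,1]$ with $\bar\xi+\bar\zeta\le1$ such that for all $\xi\in[0,\bar\xi]$, $\zeta\in[0,\bar\zeta]$, $|F((1-\xi-\zeta)m+\xi m_1+\zeta m_2)-F(m)-\xi DF(m)(m_1-m)-\zeta DF(m)(m_2-m)|\le\varepsilon(\xi+\zeta)$. Moreover $DF(m)$ has a continuous representative dominated by $|x|^p$. (Strict differentiability of $G$) For every $m\in\bar{B}_p(R)$ there is a linear map $DG(m):\widehat{\mathcal{M}}_p(\mathbb{R}^n)\to\mathbb{R}^N$ such that for all $m_1,m_2\in\bar{B}_p(R)$ and all $\varepsilon>0$ there are $\bar\xi,\bar\zeta\in(0,1]$ with $\bar\xi+\bar\zeta\le1$ such that for all $\xi_a,\xi_b\in[0,\bar\xi]$, $\zeta_a,\zeta_b\in[0,\bar\zeta]$, with $m_i=(1-\xi_i-\zeta_i)m+\xi_i m_1+\zeta_i m_2$ for $i\in\{a,b\}$, $|G(m_b)-G(m_a)-(\xi_b-\xi_a)DG(m)(m_1-m)-(\zeta_b-\zeta_a)DG(m)(m_2-m)|\le\varepsilon(|\xi_b-\xi_a|+|\zeta_b-\zeta_a|)$.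 Moreover $DG(m)$ has a continuous representative dominated by $|x|^p$. Lipschitz-derivative assumption. There exist $K_1,K_2>0$ such that for all $m_1,m_2,m_3,m_4\in\bar{B}_p(R)$: $|(DF(m_2)-DF(m_1))(m_4-m_3)|\le K_1d_1(m_1,m_2)d_1(m_3,m_4)$, $|(DG(m_2)-DG(m_1))(m_4-m_3)|\le K_1d_1(m_1,m_2)d_1(m_3,m_4)$, $|DF(m_1)(m_4-m_3)|\le K_2d_1(m_3,m_4)$, $|DG(m_1)(m_4-m_3)|\le K_2d_1(m_3,m_4)$. Augmented Lagrangian. For $(m,s,\lambda,c)\in\mathrm{cl}(\mathcal{R})\times\mathbb{R}^N\times\mathbb{R}^N\times\mathbb{R}_+$, $L_A(m,s,\lambda,c)=F(m)+\langle\lambda,G(m)+s\rangle+\frac{c}{2}|G(m)+s|^2$ (Euclidean norm), with derivative in $m$: $DL_A(m,s,\lambda,c)\hat m=DF(m)\hat m+\langle\lambda+c(G(m)+s),DG(m)\hat m\rangle$ for $\hat m\in\widehat{\mathcal{M}}_p(\mathbb{R}^n)$. Projected gradient algorithm. Input $m_{\mathrm{init}}\in\mathrm{cl}(\mathcal{R})$, $s_{\mathrm{init}}\in\mathbb{R}^N_{\ge0}$, $\lambda\in\mathbb{R}^N$, $c>0$, $\omega>0$. Set $m_0=m_{\mathrm{init}}$, $s_0=s_{\mathrm{init}}$. For $\ell=0,1,2,\dots$: (1) let $\tilde m_\ell$ be a solution to $\inf_{m\in\mathrm{cl}(\mathcal{R})}DL_A(m_\ell,s_\ell,\lambda,c)(m-m_\ell)$;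 (2) set $\delta s_\ell=-(\lambda+c(G(m_\ell)+s_\ell))$ and $\varepsilon_\ell=\max\big(DL_A(m_\ell,s_\ell,\lambda,c)(m_\ell-\tilde m_\ell),\ |s_\ell-\max(s_\ell+\delta s_\ell,0)|_\infty\big)$, the inner $\max$ with $0$ being coordinatewise; (3) if $\varepsilon_\ell\le\omega$, stop and output $(m_\ell,s_\ell,\varepsilon_\ell)$; (4) otherwise let $\theta_\ell\in[0,1]$ be a solution to $\inf_{\theta\in[0,1]}L_A\big((1-\theta)m_\ell+\theta\tilde m_\ell,\max(s_\ell+\theta\delta s_\ell,0),\lambda,c\big)$, and set $m_{\ell+1}=(1-\theta_\ell)m_\ell+\theta_\ell\tilde m_\ell$, $s_{\ell+1}=\max(s_\ell+\theta_\ell\delta s_\ell,0)$. *)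

(* Defs.v *)
From HB Require Import structures.
From mathcomp Require Import all_boot all_order all_algebra.
From mathcomp Require Import all_classical all_reals all_analysis.

Set Implicit Arguments.
Unset Strict Implicit.
Unset Printing Implicit Defensive.

Import Order.TTheory GRing.Theory Num.Theory.
Import numFieldNormedType.Exports.

Local Open Scope classical_set_scope.
Local Open Scope ring_scope.

Section MatrixBorel.
Context (R : realType) (m n : nat).

Definition mx_borel : set (set 'M[R]_(m, n)) := <<s @open 'M[R]_(m, n) >>.

Let mx_borel0 : mx_borel set0.
Proof. exact: sigma_algebra0. Qed.

Let mx_borelC A : mx_borel A -> mx_borel (~` A).
Proof. exact: sigma_algebraC. Qed.

Let mx_borel_bigcup (A : (set 'M[R]_(m, n))^nat) :
  (forall i, mx_borel (A i)) -> mx_borel (\bigcup_i A i).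
Proof. exact: sigma_algebra_bigcup. Qed.

HB.instance Definition _ :=
  @isMeasurable.Build (sigma_display mx_borel) 'M[R]_(m, n) mx_borel
    mx_borel0 mx_borelC mx_borel_bigcup.

End MatrixBorel.

(* The norm [`|v|] that the library puts on matrices is the sup norm. *)
Definition enorm (R : realType) (m n : nat) (A : 'M[R]_(m, n)) : R :=
  Num.sqrt (\sum_(i < m) \sum_(j < n) A i j ^+ 2).

Definition dotv (R : realType) (n : nat) (u v : 'rV[R]_n) : R :=
  \sum_(i < n) u 0 i * v 0 i.

Definition supnorm (R : realType) (n : nat) (v : 'rV[R]_n) : R :=
  \big[Num.max/0]_(i < n) `|v 0 i|.

Definition vpos (R : realType) (n : nat) (v : 'rV[R]_n) : 'rV[R]_n :=
  \row_(i < n) Num.max (v 0 i) 0.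

Section Measures.
Context (R : realType) (n : nat).
Local Notation E := 'rV[R]_n.
Local Notation prob := (probability E R).
Implicit Types (m : prob) (mu nu : {charge set E -> \bar R}).

Definition moment (q : R) (mu : set E -> \bar R) : \bar R :=
  (\int[mu]_x (enorm x `^ q)%:E)%E.

Definition Pset (q : R) : set prob := [set m | (moment q m < +oo)%E].

Definition Bbar (p rad : R) : set prob :=
  [set m | Pset p m /\ (moment p m <= rad%:E)%E].

Definition coupling m1 m2 : set (probability (E * E)%type R) :=
  [set pi | forall A : set E, measurable A ->
     pi (A `*` setT) = m1 A /\ pi (setT `*` A) = m2 A].

Definition transport_cost (pi : probability (E * E)%type R) : \bar R :=
  (\int[pi]_z (enorm (z.2 - z.1))%:E)%E.

(* Meaningful on [Pset 1], where the infimum is finite. *)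
Definition d1 m1 m2 : R :=
  fine (ereal_inf [set transport_cost pi | pi in coupling m1 m2]).

Definition d1_closure (A : set prob) : set prob :=
  [set m | Pset 1 m /\
     forall e : R, 0 < e -> exists m', [/\ A m', Pset 1 m' & d1 m m' < e]].

Definition d1_open (O : set prob) : Prop :=
  O `<=` Pset 1 /\
  forall m, O m -> exists2 e : R, 0 < e &
    forall m', Pset 1 m' -> d1 m m' < e -> O m'.

Definition d1_compact (C : set prob) : Prop :=
  C `<=` Pset 1 /\
  forall OO : set (set prob),
    (forall O, OO O -> d1_open O) -> C `<=` \bigcup_(O in OO) O ->
    exists DD : set (set prob),
      [/\ finite_set DD, DD `<=` OO & C `<=` \bigcup_(O in DD) O].

(* Convex combinations [(1 - t) m1 + t m2] and
   [(1 - xi - zeta) m0 + xi m1 + zeta m2] are described by their values on measurable sets; the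
   values of a measure of the library on the other sets are irrelevant. *)
Definition is_mix (t : R) m1 m2 m : Prop :=
  forall A : set E, measurable A ->
    m A = ((1 - t)%:E * m1 A + t%:E * m2 A)%E.

Definition is_mix3 (xi zeta : R) m0 m1 m2 m : Prop :=
  forall A : set E, measurable A ->
    m A = ((1 - xi - zeta)%:E * m0 A + xi%:E * m1 A + zeta%:E * m2 A)%E.

Definition mix_convex (C : set prob) : Prop :=
  forall (t : R) m1 m2 m, 0 <= t <= 1 -> C m1 -> C m2 -> is_mix t m1 m2 m ->
    C m.

Definition diffp m1 m2 : {charge set E -> \bar R} :=
  cadd (charge_of_finite_measure m1) (copp (charge_of_finite_measure m2)).

(* A chosen Hahn decomposition; the Jordan decomposition deduced from it does
   not depend on the choice. *)
Definition hahn_pos mu : set E := projT1 (cid (Hahn_decomposition mu)).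
Definition hahn_neg mu : set E :=
  projT1 (cid (projT2 (cid (Hahn_decomposition mu)))).
Definition hahnP mu : hahn_decomposition mu (hahn_pos mu) (hahn_neg mu) :=
  projT2 (cid (projT2 (cid (Hahn_decomposition mu)))).

Definition total_variation mu : {measure set E -> \bar R} :=
  charge_variation (hahnP mu).

Definition charge_integral mu (f : E -> R) : \bar R :=
  (\int[jordan_pos (hahnP mu)]_x (f x)%:E -
   \int[jordan_neg (hahnP mu)]_x (f x)%:E)%E.

Definition Mhat (p : R) : set ({charge set E -> \bar R}%R) :=
  [set mu | (moment p (total_variation mu) < +oo)%E /\ mu setT = 0%E].

Definition linear_on_Mhat (p : R) (V : lmodType R)
    (L : {charge set E -> \bar R} -> V) : Prop :=
  forall (a : R) mu nu, Mhat p mu -> Mhat p nu ->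
    L (cadd (cscale a mu) nu) = a *: L mu + L nu.

Definition representative (p : R) (L : {charge set E -> \bar R} -> R)
    (phi : E -> R) : Prop :=
  forall mu, Mhat p mu ->
    (total_variation mu).-integrable setT (EFin \o phi) /\
    (L mu)%:E = charge_integral mu phi.

Definition dominated (p : R) (q : nat) (phi : E -> 'rV[R]_q) : Prop :=
  forall e : R, 0 < e -> exists2 r : R, 0 < r &
    forall x : E, r <= enorm x -> enorm (phi x) <= e * enorm x `^ p.

Definition d1_continuous_on (B : set prob) (V : zmodType) (nrm : V -> R)
    (f : prob -> V) : Prop :=
  forall m, B m -> forall e : R, 0 < e -> exists2 delta : R, 0 < delta &
    forall m', B m' -> d1 m m' < delta -> nrm (f m' - f m) < e.

Definition differentiable_F (p rad : R) (F : prob -> R)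
    (DF : prob -> {charge set E -> \bar R} -> R) : Prop :=
  forall m, Bbar p rad m ->
  [/\ linear_on_Mhat p (V := R^o) (DF m),
      forall m1 m2, Bbar p rad m1 -> Bbar p rad m2 ->
      forall e : R, 0 < e ->
      exists xibar zetabar : R,
        [/\ 0 < xibar <= 1, 0 < zetabar <= 1, xibar + zetabar <= 1 &
        forall (xi zeta : R) m', 0 <= xi <= xibar -> 0 <= zeta <= zetabar ->
          is_mix3 xi zeta m m1 m2 m' ->
          `|F m' - F m - xi * DF m (diffp m1 m) - zeta * DF m (diffp m2 m)|
            <= e * (xi + zeta)] &
      exists phi : E -> R,
        [/\ continuous phi, dominated p (fun x => \row_(i < 1) phi x)
          & representative p (DF m) phi]].

Definition strictly_differentiable_G (p rad : R) (N : nat)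
    (G : prob -> 'rV[R]_N)
    (DG : prob -> {charge set E -> \bar R} -> 'rV[R]_N) : Prop :=
  forall m, Bbar p rad m ->
  [/\ linear_on_Mhat p (DG m),
      forall m1 m2, Bbar p rad m1 -> Bbar p rad m2 ->
      forall e : R, 0 < e ->
      exists xibar zetabar : R,
        [/\ 0 < xibar <= 1, 0 < zetabar <= 1, xibar + zetabar <= 1 &
        forall (xia xib zetaa zetab : R) ma mb,
          0 <= xia <= xibar -> 0 <= xib <= xibar ->
          0 <= zetaa <= zetabar -> 0 <= zetab <= zetabar ->
          is_mix3 xia zetaa m m1 m2 ma -> is_mix3 xib zetab m m1 m2 mb ->
          enorm (G mb - G ma - (xib - xia) *: DG m (diffp m1 m)
                 - (zetab - zetaa) *: DG m (diffp m2 m))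
            <= e * (`|xib - xia| + `|zetab - zetaa|)] &
      exists phi : E -> 'rV[R]_N,
        [/\ continuous phi, dominated p phi
          & forall i : 'I_N,
              representative p (fun mu => DG m mu 0 i) (fun x => phi x 0 i)]].

Definition lipschitz_derivatives (p rad : R) (N : nat)
    (DF : prob -> {charge set E -> \bar R} -> R)
    (DG : prob -> {charge set E -> \bar R} -> 'rV[R]_N) : Prop :=
  exists K1 K2 : R, [/\ 0 < K1, 0 < K2 &
    forall m1 m2 m3 m4, Bbar p rad m1 -> Bbar p rad m2 ->
      Bbar p rad m3 -> Bbar p rad m4 ->
    [/\ `|DF m2 (diffp m4 m3) - DF m1 (diffp m4 m3)|
          <= K1 * d1 m1 m2 * d1 m3 m4,
        enorm (DG m2 (diffp m4 m3) - DG m1 (diffp m4 m3))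
          <= K1 * d1 m1 m2 * d1 m3 m4,
        `|DF m1 (diffp m4 m3)| <= K2 * d1 m3 m4 &
        enorm (DG m1 (diffp m4 m3)) <= K2 * d1 m3 m4]].

End Measures.

Section ControlledSDE.
Context (R : realType) (d : measure_display) (Omega : measurableType d).
Variable P : probability Omega R.
Local Notation mu := (@lebesgue_measure R).

Definition measurable_wrt (S : set (set Omega)) d' (T' : measurableType d')
    (f : Omega -> T') : Prop :=
  forall B : set T', measurable B -> S (f @^-1` B).

Definition noise_algebra (nW : nat) (W : R -> Omega -> 'rV[R]_nW) (s : R) :
    set (set Omega) :=
  <<s [set A | exists (theta : R) (B : set 'rV[R]_nW),
        [/\ 0 <= theta <= s, measurable B &
            A = (fun w => W theta w - W 0 w) @^-1` B]] >>.

(* The product formula with [A = setT] says that the increments are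
   N(0, (t - s) I); for general [A] it adds their independence of the past. *)
Definition brownian_motion (T : R) (nW : nat)
    (W : R -> Omega -> 'rV[R]_nW) : Prop :=
  [/\ forall t, 0 <= t <= T -> measurable_fun setT (W t),
      {ae P, forall w, {within `[0, T], continuous (fun t => W t w)}} &
      forall (s t : R) (A : set Omega) (B : 'I_nW -> set R),
        0 <= s -> s < t -> t <= T ->
        noise_algebra W s A -> (forall i, measurable (B i)) ->
        P (A `&` [set w | forall i, B i (W t w 0 i - W s w 0 i)]) =
        (P A * \big[*%E/1%E]_(i < nW) normal_prob 0 (Num.sqrt (t - s)) (B i))%E].

Definition independent_of_noise (T : R) (n nW : nat) (Y0 : Omega -> 'rV[R]_n)
    (W : R -> Omega -> 'rV[R]_nW) : Prop :=
  forall (B : set 'rV[R]_n) (A : set Omega),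
    measurable B -> noise_algebra W T A ->
    P (Y0 @^-1` B `&` A) = (P (Y0 @^-1` B) * P A)%E.

Definition filtration (n nW : nat) (Y0 : Omega -> 'rV[R]_n)
    (W : R -> Omega -> 'rV[R]_nW) (s : R) : set (set Omega) :=
  <<s [set Y0 @^-1` B | B in @measurable _ 'rV[R]_n] `|` noise_algebra W s >>.

Definition jointly_measurable (T : R) (k : nat) (u : R -> Omega -> 'rV[R]_k) :
    Prop :=
  measurable_fun (`[0, T] `*` setT)
    (fun z : measurableTypeR R * Omega => u z.1 z.2).

Definition admissible_control (T : R) (k : nat) (U : set 'rV[R]_k)
    (G : R -> set (set Omega)) (u : R -> Omega -> 'rV[R]_k) : Prop :=
  [/\ jointly_measurable T u,
      forall s w, 0 <= s <= T -> U (u s w) &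
      forall s, 0 <= s <= T -> measurable_wrt (G s) (u s)].

(* The process sum_i sp_coef i * 1_]sp_time i, sp_time (i + 1)]. *)
Record simple_process := SimpleProcess {
  sp_size : nat;
  sp_time : nat -> R;
  sp_coef : nat -> Omega -> R }.

Definition simple_adapted (G : R -> set (set Omega)) (t : R)
    (H : simple_process) : Prop :=
  [/\ forall i, (i <= sp_size H)%N -> 0 <= sp_time H i <= t,
      forall i, (i < sp_size H)%N -> sp_time H i <= sp_time H i.+1,
      forall i, (i < sp_size H)%N ->
        measurable_wrt (G (sp_time H i)) (sp_coef H i) &
      exists M : R, forall i w, (i < sp_size H)%N -> `|sp_coef H i w| <= M].

Definition simple_val (H : simple_process) (s : R) (w : Omega) : R :=
  \sum_(i < sp_size H)
    sp_coef H i w * \1_`]sp_time H i, sp_time H i.+1] s.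

Definition simple_integral (B : R -> Omega -> R) (H : simple_process)
    (w : Omega) : R :=
  \sum_(i < sp_size H)
    sp_coef H i w * (B (sp_time H i.+1) w - B (sp_time H i) w).

(* [I] is (a version of) the Ito integral over [0, t] of the square-integrable
   process [h] against [B], i.e. an L^2 limit of integrals of simple
   processes converging to [h] in L^2(dP x ds). *)
Definition is_ito_integral (G : R -> set (set Omega)) (B : R -> Omega -> R)
    (t : R) (h : R -> Omega -> R) (I : Omega -> R) : Prop :=
  measurable_fun setT I /\
  exists H : nat -> simple_process,
    [/\ forall j, simple_adapted G t (H j),
        (fun j => \int[P]_w \int[mu]_(s in `[0%R, t])
           ((simple_val (H j) s w - h s w) ^+ 2)%:E)%E @ \oo --> 0%E &
        (fun j => \int[P]_w
           ((simple_integral B (H j) w - I w) ^+ 2)%:E)%E @ \oo --> 0%E].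

(* Strong solutions: [X] is adapted to the filtration augmented with the
   [P]-null sets, which is what the second condition says. The integrability
   condition is automatic for continuous adapted solutions (the initial
   condition has a finite second moment) and makes the Ito integrals of
   [is_ito_integral] meaningful. *)
Definition sde_solution (T : R) (n nW k : nat)
    (b : 'rV[R]_n -> 'rV[R]_k -> 'rV[R]_n)
    (sigma : 'rV[R]_n -> 'rV[R]_k -> 'M[R]_(n, nW))
    (W : R -> Omega -> 'rV[R]_nW) (Y0 : Omega -> 'rV[R]_n)
    (u : R -> Omega -> 'rV[R]_k) (X : R -> Omega -> 'rV[R]_n) : Prop :=
  [/\ jointly_measurable T X,
      forall s, 0 <= s <= T -> exists Z : Omega -> 'rV[R]_n,
        measurable_wrt (filtration Y0 W s) Z /\ {ae P, forall w, X s w = Z w},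
      {ae P, forall w, {within `[0, T], continuous (fun t => X t w)}},
      (\int[P]_w \int[mu]_(s in `[0%R, T]) (enorm (X s w) ^+ 2)%:E < +oo)%E &
      forall t, 0 <= t <= T -> exists I : 'I_n -> 'I_nW -> Omega -> R,
        (forall i j, is_ito_integral (filtration Y0 W) (fun s w => W s w 0 j) t
           (fun s w => sigma (X s w) (u s w) i j) (I i j)) /\
        {ae P, forall w, forall i : 'I_n,
          X t w 0 i = Y0 w 0 i
            + Rintegral mu `[0, t] (fun s => b (X s w) (u s w) 0 i)
            + \sum_(j < nW) I i j w}].

(* The laws at time [T] of the controlled processes. *)
Definition reachable (T : R) (n nW k : nat) (U : set 'rV[R]_k)
    (b : 'rV[R]_n -> 'rV[R]_k -> 'rV[R]_n)
    (sigma : 'rV[R]_n -> 'rV[R]_k -> 'M[R]_(n, nW))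
    (W : R -> Omega -> 'rV[R]_nW) (Y0 : Omega -> 'rV[R]_n) :
    set (probability 'rV[R]_n R) :=
  [set m | exists (u : R -> Omega -> 'rV[R]_k) (X : R -> Omega -> 'rV[R]_n),
     [/\ admissible_control T U (filtration Y0 W) u,
         sde_solution T b sigma W Y0 u X &
         forall A, measurable A -> m A = pushforward P (X T) A]].

End ControlledSDE.

Definition sde_coefficients (R : realType) (n nW k : nat) (U : set 'rV[R]_k)
    (b : 'rV[R]_n -> 'rV[R]_k -> 'rV[R]_n)
    (sigma : 'rV[R]_n -> 'rV[R]_k -> 'M[R]_(n, nW)) : Prop :=
  exists2 K : R, 0 < K &
    forall x y u v, U u -> U v ->
      enorm (b x u) + enorm (sigma x u) <= K * (1 + enorm x + enorm u) /\
      enorm (b x u - b y v) + enorm (sigma x u - sigma y v)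
        <= K * (enorm (y - x) + enorm (v - u)).

Section Algorithm.
Context (R : realType) (n N : nat).
Local Notation E := 'rV[R]_n.
Local Notation prob := (probability E R).
Variables (C : set prob) (F : prob -> R) (G : prob -> 'rV[R]_N).
Variables (DF : prob -> {charge set E -> \bar R} -> R).
Variables (DG : prob -> {charge set E -> \bar R} -> 'rV[R]_N).

Definition LA (m : prob) (s lambda : 'rV[R]_N) (c : R) : R :=
  F m + dotv lambda (G m + s) + c / 2 * enorm (G m + s) ^+ 2.

Definition DLA (m : prob) (s lambda : 'rV[R]_N) (c : R)
    (mhat : {charge set E -> \bar R}) : R :=
  DF m mhat + dotv (lambda + c *: (G m + s)) (DG m mhat).

Definition delta_s (m : prob) (s lambda : 'rV[R]_N) (c : R) : 'rV[R]_N :=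
  - (lambda + c *: (G m + s)).

Definition criterion (m mt : prob) (s lambda : 'rV[R]_N) (c : R) : R :=
  Num.max (DLA m s lambda c (diffp m mt))
          (supnorm (s - vpos (s + delta_s m s lambda c))).

Definition direction_step (m mt : prob) (s lambda : 'rV[R]_N) (c : R) : Prop :=
  C mt /\ forall m', C m' ->
    DLA m s lambda c (diffp mt m) <= DLA m s lambda c (diffp m' m).

Definition update_step (m mt : prob) (s lambda : 'rV[R]_N) (c theta : R)
    (mnext : prob) (snext : 'rV[R]_N) : Prop :=
  let s_at t := vpos (s + t *: delta_s m s lambda c) in
  [/\ 0 <= theta <= 1, is_mix theta m mt mnext, snext = s_at theta &
      forall t m', 0 <= t <= 1 -> is_mix t m mt m' ->
        LA mnext snext lambda c <= LA m' (s_at t) lambda c].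

(* The sequences are constrained only as long as the stopping test has not
   succeeded; their values after that are arbitrary. *)
Definition algorithm_run (minit : prob) (sinit lambda : 'rV[R]_N) (c omega : R)
    (m mt : nat -> prob) (s : nat -> 'rV[R]_N) (theta : nat -> R) : Prop :=
  let continues l := omega < criterion (m l) (mt l) (s l) lambda c in
  [/\ m 0%N = minit, s 0%N = sinit,
      forall l, (forall j, (j < l)%N -> continues j) ->
        direction_step (m l) (mt l) (s l) lambda c &
      forall l, (forall j, (j <= l)%N -> continues j) ->
        update_step (m l) (mt l) (s l) lambda c (theta l) (m l.+1) (s l.+1)].

End Algorithm.

(* Main.v *)
Require Import Defs.
From HB Require Import structures.
From mathcomp Require Import all_boot all_order all_algebra.
From mathcomp Require Import all_classical all_reals all_analysis.
From mathcomp Require Import measurable_realfun ring lra.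
Import Order.TTheory GRing.Theory Num.Theory.
Import numFieldNormedType.Exports.
Set Implicit Arguments.
Unset Strict Implicit.
Unset Printing Implicit Defensive.
Local Open Scope classical_set_scope.
Local Open Scope ring_scope.

(* Every m in cl(R) still satisfies the p-th moment bound: truncated powers of |x| are Lipschitz, so
   their integrals pass to the d1-limit, and monotone convergence removes the truncation. All the
   d1-distances that occur are estimated with the explicit coupling (1 - t) diag + t (m (x) mt) of m
   and (1 - t) m + t mt, whose cost is at most t times a constant.

   Along the segment from m to mt the mean value theorem and the Lipschitz bounds on the derivatives
   give F(m_t) = F(m) + t DF(m)(mt - m) + O(t^2), likewise for G, with uniform constants. Writing
   y = lambda + c (G(m) + s), one has L_A = F + (|y|^2 - |lambda|^2) / (2c); as F is bounded below on
   cl(R), L_A is bounded below, and y stays bounded along the iterates since L_A decreases. Hence for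
   every t in [0, 1] one step of length t changes L_A by at most - t min(omega, omega^2) + M t^2, with
   M independent of the iterate, as long as the stopping test fails: the first-order decrease is
   t times DL_A(m - mt) + |s - max(s - y, 0)|^2. The exact line search therefore gains at least a fixed
   positive amount per iteration, which cannot go on forever. *)

(** * The Euclidean norm *)

Section Enorm.
Context (R : realType).

Lemma enormE n (x : 'rV[R]_n) : enorm x = Num.sqrt (\sum_i x 0 i ^+ 2).
Proof. by rewrite /enorm big_ord1. Qed.

Lemma enorm_ge0 n (x : 'rV[R]_n) : 0 <= enorm x.
Proof. exact: sqrtr_ge0. Qed.

Lemma sqr_enorm n (x : 'rV[R]_n) : enorm x ^+ 2 = \sum_i x 0 i ^+ 2.
Proof. by rewrite enormE sqr_sqrtr// sumr_ge0// => i _; rewrite sqr_ge0. Qed.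

Lemma ler_coord_enorm n (x : 'rV[R]_n) i : `|x 0 i| <= enorm x.
Proof.
rewrite -(ler_pXn2r (n := 2))// ?nnegrE ?enorm_ge0// sqr_enorm real_normK ?num_real//.
by rewrite (bigD1 i)//= lerDl sumr_ge0// => j _; rewrite sqr_ge0.
Qed.

(** Cauchy-Schwarz from weighted Young inequalities: with [a] and [b] the two norms, each product of
    coordinates is at most half of [b / a * x_i ^+ 2 + a / b * y_i ^+ 2], and these bounds sum to
    [a * b]. The weights divide by the norms, hence the separate zero cases. *)
Lemma dotv_le_enorm n (x y : 'rV[R]_n) : dotv x y <= enorm x * enorm y.
Proof.
have [x0|x0] := eqVneq (enorm x) 0.
  rewrite x0 mul0r /dotv big1// => i _.
  by have := ler_coord_enorm x i; rewrite x0 normr_le0 => /eqP ->; rewrite mul0r.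
have [y0|y0] := eqVneq (enorm y) 0.
  rewrite y0 mulr0 /dotv big1// => i _.
  by have := ler_coord_enorm y i; rewrite y0 normr_le0 => /eqP ->; rewrite mulr0.
have x_gt0 : 0 < enorm x by rewrite lt0r x0 enorm_ge0.
have y_gt0 : 0 < enorm y by rewrite lt0r y0 enorm_ge0.
set a := enorm x; set b := enorm y.
have -> : a * b = \sum_i (b / a * x 0 i ^+ 2 + a / b * y 0 i ^+ 2) / 2.
  rewrite -mulr_suml big_split/= -!mulr_sumr -!sqr_enorm -/a -/b.
  by field; rewrite /a /b x0 y0.
apply: ler_sum => i _.
have h : 0 <= (b * x 0 i - a * y 0 i) ^+ 2 / (2 * a * b).
  by rewrite divr_ge0 ?sqr_ge0// !mulr_ge0 ?enorm_ge0.
rewrite -subr_ge0; congr (0 <= _): h.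
by field; rewrite /a /b x0 y0.
Qed.

Lemma enormD n (x y : 'rV[R]_n) : enorm (x + y) <= enorm x + enorm y.
Proof.
rewrite -(ler_pXn2r (n := 2))// ?nnegrE ?addr_ge0 ?enorm_ge0//.
rewrite sqrrD !sqr_enorm.
under eq_bigr do rewrite !mxE sqrrD.
rewrite !big_split/= lerD2r lerD2l mulr2n.
by rewrite lerD// dotv_le_enorm.
Qed.

Lemma enormN n (x : 'rV[R]_n) : enorm (- x) = enorm x.
Proof. by rewrite !enormE; under eq_bigr do rewrite mxE sqrrN. Qed.

Lemma enorm_sub_le n (x y : 'rV[R]_n) : enorm (y - x) <= enorm x + enorm y.
Proof. by rewrite addrC -[enorm x]enormN; exact: enormD. Qed.

Lemma enorm_le_sub n (x y : 'rV[R]_n) : enorm x <= enorm y + enorm (y - x).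
Proof.
by rewrite -[enorm (y - x)]enormN opprB -{1}(subrKC y x); exact: enormD.
Qed.

Lemma measurable_coord n (i : 'I_n) :
  measurable_fun [set: 'rV[R]_n] (fun x : 'rV[R]_n => x 0 i : R).
Proof.
apply: (measurability _ (RGenOpens.measurableE R)) => _ [_ [a [b ->] <-]].
rewrite setTI; apply: sub_sigma_algebra.
have := @coord_continuous R 1 n 0 i; rewrite continuousP => /(_ `]a, b[%classic).
by apply; exact: interval_open.
Qed.

Lemma measurable_enorm n d (T : measurableType d) (f : T -> 'rV[R]_n) :
  (forall i, measurable_fun setT (fun t => f t 0 i)) ->
  measurable_fun setT (fun t => enorm (f t)).
Proof.
move=> mf; under eq_fun do rewrite enormE.
apply: (measurableT_comp (f := @Num.sqrt R)).
  exact: continuous_measurable_fun (@sqrt_continuous R).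
by apply: measurable_sum => i; exact: measurable_funX.
Qed.

End Enorm.

(** * Mixtures and couplings of probability measures *)

Section MixtureMeasure.
Context (R : realType) (d : measure_display) (T : measurableType d).
Variables (t : R) (t01 : 0 <= t <= 1) (P Q : probability T R).

Let t_ge0 : 0 <= t. Proof. by case/andP: t01. Qed.
Let onem_ge0 : 0 <= 1 - t. Proof. by case/andP: t01; rewrite subr_ge0. Qed.

(** [is_mix] only specifies a mixture; this measure shows that one exists for every weight in
    [0, 1]. *)
Definition mixture : set T -> \bar R :=
  measure_add (mscale (NngNum onem_ge0) P) (mscale (NngNum t_ge0) Q).

HB.instance Definition _ := Measure.on mixture.

Lemma mixtureE A : mixture A = ((1 - t)%:E * P A + t%:E * Q A)%E.
Proof. by rewrite /mixture measure_addE. Qed.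

Let mixture_setT : mixture setT = 1%E.
Proof. by rewrite mixtureE !probability_setT !mule1 -EFinD subrK. Qed.

HB.instance Definition _ := Measure_isProbability.Build _ _ _
  mixture mixture_setT.

Lemma ge0_integral_mixture (f : T -> R) :
  (forall x, 0 <= f x) -> measurable_fun setT f ->
  (\int[mixture]_x (f x)%:E =
   (1 - t)%:E * \int[P]_x (f x)%:E + t%:E * \int[Q]_x (f x)%:E)%E.
Proof.
move=> f0 mf; rewrite ge0_integral_measure_add//; last 2 first.
  by move=> x _; rewrite lee_fin.
  exact/measurable_EFinP.
by rewrite !ge0_integral_mscale//; [exact/measurable_EFinP|
  move=> x _; rewrite lee_fin|exact/measurable_EFinP|
  move=> x _; rewrite lee_fin].
Qed.

End MixtureMeasure.

(** * Couplings, transport costs and upper bounds on [d1] *)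

Section Transport.
Context (R : realType) (n : nat).
Local Notation E := 'rV[R]_n.
Implicit Types m : probability E R.

Lemma measurable_fun_enorm : measurable_fun setT (@enorm R 1 n).
Proof. by apply: measurable_enorm => i; exact: measurable_coord. Qed.

Lemma measurable_fun_enorm_sub :
  measurable_fun setT (fun z : E * E => enorm (z.2 - z.1)).
Proof.
apply: measurable_enorm => i; under eq_fun do rewrite !mxE.
apply: measurable_funB.
  exact: (measurableT_comp (@measurable_coord R n i) measurable_snd).
exact: (measurableT_comp (@measurable_coord R n i) measurable_fst).
Qed.

Lemma ge0_integral_coupling_fst m1 m2 pi (f : E -> R) :
  coupling m1 m2 pi -> (forall x, 0 <= f x) -> measurable_fun setT f ->
  (\int[pi]_z (f z.1)%:E = \int[m1]_x (f x)%:E)%E.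
Proof.
move=> cpl f0 mf.
transitivity (\int[pushforward pi (fst : E * E -> E)]_x (f x)%:E)%E.
  rewrite (ge0_integral_pushforward measurable_fst)//.
    exact/measurable_EFinP.
  by move=> x _; rewrite lee_fin.
apply: eq_measure_integral => A mA _.
have [piA _] := cpl A mA; apply: etrans piA.
rewrite /pushforward; congr (pi _).
by apply/seteqP; split => -[x y]//= [].
Qed.

Lemma ge0_integral_coupling_snd m1 m2 pi (f : E -> R) :
  coupling m1 m2 pi -> (forall x, 0 <= f x) -> measurable_fun setT f ->
  (\int[pi]_z (f z.2)%:E = \int[m2]_x (f x)%:E)%E.
Proof.
move=> cpl f0 mf.
transitivity (\int[pushforward pi (snd : E * E -> E)]_x (f x)%:E)%E.
  rewrite (ge0_integral_pushforward measurable_snd)//.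
    exact/measurable_EFinP.
  by move=> x _; rewrite lee_fin.
apply: eq_measure_integral => A mA _.
have [_ piA] := cpl A mA; apply: etrans piA.
rewrite /pushforward; congr (pi _).
by apply/seteqP; split => -[x y]//= [].
Qed.

Lemma coupling_product m1 m2 : coupling m1 m2 (m1 \x m2)%E.
Proof.
move=> A mA; split; rewrite /= product_measure1E//.
  by rewrite [X in (_ * X)%E](probability_setT m2) mule1.
by rewrite [X in (X * _)%E](probability_setT m1) mul1e.
Qed.

Lemma transport_cost_ge0 pi : (0 <= @transport_cost R n pi)%E.
Proof. by apply: integral_ge0 => z _; rewrite lee_fin enorm_ge0. Qed.

Lemma transport_cost_le_moments m1 m2 pi : coupling m1 m2 pi ->
  (transport_cost pi <=
   \int[m1]_x (enorm x)%:E + \int[m2]_x (enorm x)%:E)%E.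
Proof.
move=> cpl.
rewrite -(ge0_integral_coupling_fst cpl (@enorm_ge0 R n) measurable_fun_enorm).
rewrite -(ge0_integral_coupling_snd cpl (@enorm_ge0 R n) measurable_fun_enorm).
have m1n : measurable_fun setT (fun z : E * E => (enorm z.1)%:E).
  apply/measurable_EFinP.
  exact: (measurableT_comp measurable_fun_enorm measurable_fst).
have m2n : measurable_fun setT (fun z : E * E => (enorm z.2)%:E).
  apply/measurable_EFinP.
  exact: (measurableT_comp measurable_fun_enorm measurable_snd).
rewrite -ge0_integralD//; last 2 first.
  by move=> z _; rewrite lee_fin enorm_ge0.
  by move=> z _; rewrite lee_fin enorm_ge0.
apply: ge0_le_integral => //.
- by move=> z _; rewrite lee_fin enorm_ge0.
- by apply/measurable_EFinP; exact: measurable_fun_enorm_sub.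
- exact: emeasurable_funD.
- by move=> z _; rewrite -EFinD lee_fin enorm_sub_le.
Qed.

Lemma transport_inf_ge0 m1 m2 :
  (0 <= ereal_inf [set transport_cost pi | pi in coupling m1 m2])%E.
Proof. by apply: le_ereal_inf_tmp => _ [pi _ <-]; exact: transport_cost_ge0. Qed.

Lemma d1_ge0 m1 m2 : 0 <= d1 m1 m2.
Proof. exact: fine_ge0 (transport_inf_ge0 _ _). Qed.

(** The real bound [x] makes the infimum finite, so that [fine] does not alter it. *)
Lemma d1_le_transport_cost m1 m2 pi (x : R) :
  coupling m1 m2 pi -> (transport_cost pi <= x%:E)%E -> d1 m1 m2 <= x.
Proof.
move=> cpl pix; have inf_le : (ereal_inf [set transport_cost pi | pi in
    coupling m1 m2] <= x%:E)%E.
  by apply: ge_ereal_inf; exists (transport_cost pi) => //; exists pi.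
rewrite -lee_fin fineK// ge0_fin_numE ?transport_inf_ge0//.
exact: le_lt_trans inf_le (ltry _).
Qed.

Lemma Pset1E m : Pset 1 m = (\int[m]_x (enorm x)%:E < +oo)%E.
Proof.
rewrite /Pset /moment/=; congr (_ < _)%E.
by apply: eq_integral => x _; rewrite powRr1 ?enorm_ge0.
Qed.

(* The first moments make the infimum in d1 finite: [fine] would turn an infinite one into 0. *)
Lemma coupling_lt_d1 m1 m2 (e : R) : Pset 1 m1 -> Pset 1 m2 -> d1 m1 m2 < e ->
  exists2 pi, coupling m1 m2 pi & (transport_cost pi < e%:E)%E.
Proof.
rewrite !Pset1E => fm1 fm2 d1e.
have inf_fin : (ereal_inf [set transport_cost pi | pi in coupling m1 m2]
    \is a fin_num)%E.
  rewrite ge0_fin_numE ?transport_inf_ge0//.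
  apply: le_lt_trans (lte_add_pinfty fm1 fm2).
  apply: le_trans (transport_cost_le_moments (@coupling_product m1 m2)).
  apply: ge_ereal_inf; exists (transport_cost (m1 \x m2)%E) => //.
  by exists (m1 \x m2)%E => //; exact: coupling_product.
have := d1e; rewrite -lte_fin fineK// => /ereal_inf_lt[_ [pi cpl <-] h].
by exists pi.
Qed.

(** A share [1 - t] of the mass stays in place at no cost (the law of [(x, x)] under [m1]); only the
    share [t] is moved, by the product coupling. *)
Lemma d1_mix_le (t D : R) m1 m2 m : 0 <= t <= 1 -> is_mix t m1 m2 m ->
  (\int[m1]_x (enorm x)%:E + \int[m2]_x (enorm x)%:E <= D%:E)%E ->
  d1 m1 m <= t * D.
Proof.
move=> t01 mixm bD.
have mdiag : measurable_fun setT (fun x : E => (x, x)).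
  by apply: measurable_fun_pair; exact: measurable_id.
pose diagm : {mfun E >-> (E * E)%type} :=
  HB.pack (fun x : E => (x, x)) (isMeasurableFun.Build _ _ _ _ _ mdiag).
pose dprob : probability (E * E)%type R := distribution m1 diagm.
pose pi := mixture t01 dprob (m1 \x m2)%E.
have cpl : coupling m1 m pi.
  move=> A mA; have [p1 p2] := @coupling_product m1 m2 A mA.
  rewrite [in LHS]/pi/= !mixtureE.
  have dA : dprob (A `*` setT) = m1 A.
    rewrite /dprob/= /distribution /pushforward; congr (m1 _).
    by apply/seteqP; split => x//= [].
  have dA' : dprob (setT `*` A) = m1 A.
    rewrite /dprob/= /distribution /pushforward; congr (m1 _).
    by apply/seteqP; split => x//= [].
  have m1A : m1 A \is a fin_num by exact: fin_num_measure.
  split.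
    rewrite dA [X in (_ + _ * X)%E]p1 -muleDl ?fin_num_adde_defl//.
    by rewrite -EFinD subrK mul1e.
  by rewrite dA' [X in (_ + _ * X)%E]p2 mixm.
apply: (d1_le_transport_cost cpl).
rewrite /transport_cost ge0_integral_mixture//=; last 2 first.
  by move=> z; exact: enorm_ge0.
  exact: measurable_fun_enorm_sub.
rewrite (_ : (\int[dprob]_x _ = 0)%E); last first.
  rewrite (ge0_integral_pushforward mdiag)//; last 2 first.
  - by apply/measurable_EFinP; exact: measurable_fun_enorm_sub.
  - by move=> z _; rewrite lee_fin enorm_ge0.
  apply: integral0_eq => x _ /=; rewrite subrr enormE big1 ?sqrtr0// => i _.
  by rewrite mxE expr0n.
rewrite mule0 add0e EFinM lee_wpmul2l ?lee_fin//; first by case/andP: (t01).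
exact: le_trans (transport_cost_le_moments (@coupling_product m1 m2)) bD.
Qed.

End Transport.

(** * Moments of limits for the Wasserstein distance *)

Section Moments.
Context (R : realType) (n : nat).
Local Notation E := 'rV[R]_n.
Implicit Types m : probability E R.

(** Mean value theorem on [b, a]; the derivative is nondecreasing because [1 <= p]. *)
Lemma powRB_le (p a b M : R) : 1 <= p -> 0 <= b -> b <= a -> a <= M ->
  a `^ p - b `^ p <= p * M `^ (p - 1) * (a - b).
Proof.
move=> p1 b0 ba aM.
have p0 : 0 < p by exact: lt_le_trans p1.
have powM c : 0 <= c -> c <= M -> c `^ (p - 1) <= M `^ (p - 1).
  move=> c0 cM; apply: ge0_ler_powR; rewrite ?nnegrE//; first by rewrite subr_ge0.
  exact: le_trans cM.
(* The derivative of the power is only available at positive points, so [b = 0] is treated by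
   hand. *)
have [->|b_neq0] := eqVneq b 0.
  rewrite powR0 ?gt_eqF// !subr0.
  have a0 : 0 <= a by exact: le_trans ba.
  rewrite -(mulr_powRB1 a0 p0) mulrC ler_wpM2r//.
  apply: le_trans (powM a a0 aM) _.
  by rewrite ler_peMl// powR_ge0.
have b_gt0 : 0 < b by rewrite lt0r b_neq0.
have der x : x \in `[b, a] -> is_derive x 1 (fun y => y `^ p) (p * x `^ (p - 1)).
  rewrite in_itv/= => /andP[bx _]; apply: is_derive1_powR.
  exact: lt_le_trans bx.
have cont : {within `[b, a], continuous (fun y : R => y `^ p)}.
  apply: derivable_within_continuous => x xba.
  exact: (@ex_derive _ _ _ _ _ _ _ (der x xba)).
have deroo x : x \in `]b, a[ ->
    is_derive x 1 (fun y => y `^ p) (p * x `^ (p - 1)).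
  by move=> xba; apply: der; exact: subset_itv_oo_cc xba.
have [c] := MVT_segment ba deroo cont.
rewrite in_itv/= => /andP[bc ca] ->.
rewrite ler_wpM2r ?subr_ge0// ler_wpM2l ?(ltW p0)//.
by apply: powM; [exact: le_trans bc|exact: le_trans aM].
Qed.

Lemma truncated_powR_le (p a b e M : R) : 1 <= p -> 0 <= M -> 0 <= a ->
  0 <= b -> 0 <= e -> a <= b + e ->
  Num.min a M `^ p <= Num.min b M `^ p + p * M `^ (p - 1) * e.
Proof.
move=> p1 M0 a0 b0 e0 abe.
have L0 : 0 <= p * M `^ (p - 1) by rewrite mulr_ge0 ?powR_ge0 ?(le_trans _ p1).
have a'0 : 0 <= Num.min a M by rewrite le_min a0.
have b'0 : 0 <= Num.min b M by rewrite le_min b0.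
have [ab|/ltW ba] := leP (Num.min a M) (Num.min b M).
  apply: ler_wpDr; first exact: mulr_ge0.
  by apply: ge0_ler_powR; rewrite ?nnegrE ?(le_trans _ p1).
rewrite -lerBlDl; apply: le_trans (@powRB_le p _ _ M p1 b'0 ba _) _.
  by rewrite ge_min lexx orbT.
rewrite ler_wpM2l// lerBlDr.
have [bM|Mb] := leP b M.
  by rewrite ge_min addrC abe.
by rewrite ge_min lerDr e0 orbT.
Qed.

Lemma measurable_truncated_powR (p M : R) :
  measurable_fun setT (fun x : E => Num.min (enorm x) M `^ p).
Proof.
apply: (measurableT_comp (measurable_powR p)).
by apply: measurable_minr; [exact: measurable_fun_enorm|exact: measurable_cst].
Qed.

(** The Lipschitz bound on the truncated power is integrated against the coupling; on the side of
    [m'] the truncation is then dropped. *)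
Lemma truncated_moment_le (p M e : R) m m' pi : 1 <= p -> 0 <= M ->
  coupling m m' pi -> (transport_cost pi <= e%:E)%E ->
  (\int[m]_x (Num.min (enorm x) M `^ p)%:E <=
   moment p m' + (p * M `^ (p - 1) * e)%:E)%E.
Proof.
move=> p1 M0 cpl pie; set L := p * M `^ (p - 1).
have L0 : 0 <= L by rewrite mulr_ge0 ?powR_ge0 ?(le_trans _ p1).
have minM0 (x : E) : 0 <= Num.min (enorm x) M by rewrite le_min enorm_ge0.
have h0 (x : E) : 0 <= Num.min (enorm x) M `^ p by exact: powR_ge0.
have mh := measurable_truncated_powR p M.
have mpow : measurable_fun setT (fun x : E => enorm x `^ p).
  by apply: (measurableT_comp (measurable_powR p)); exact: measurable_fun_enorm.
have mh1 : measurable_fun setT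
    (fun z : E * E => (Num.min (enorm z.1) M `^ p)%:E).
  by apply/measurable_EFinP; exact: (measurableT_comp mh measurable_fst).
have mh2 : measurable_fun setT
    (fun z : E * E => (Num.min (enorm z.2) M `^ p)%:E).
  by apply/measurable_EFinP; exact: (measurableT_comp mh measurable_snd).
have mc : measurable_fun setT (fun z : E * E => (enorm (z.2 - z.1))%:E).
  by apply/measurable_EFinP; exact: measurable_fun_enorm_sub.
have mLc : measurable_fun setT
    (fun z : E * E => L%:E * (enorm (z.2 - z.1))%:E)%E.
  by apply/measurable_EFinP; apply: measurable_funM => //;
    exact: measurable_fun_enorm_sub.
rewrite -(ge0_integral_coupling_fst cpl h0 mh).
apply: (@le_trans _ _ (\int[pi]_z
  ((Num.min (enorm z.2) M `^ p)%:E + L%:E * (enorm (z.2 - z.1))%:E))%E).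
  apply: ge0_le_integral => //.
  - by move=> z _; rewrite lee_fin.
  - exact: emeasurable_funD.
  - move=> z _; rewrite -EFinM -EFinD lee_fin.
    by apply: truncated_powR_le; rewrite ?enorm_ge0// enorm_le_sub.
rewrite ge0_integralD//; last 2 first.
  by move=> z _; rewrite lee_fin.
  by move=> z _; rewrite -EFinM lee_fin mulr_ge0 ?enorm_ge0.
rewrite (ge0_integral_coupling_snd cpl h0 mh).
rewrite ge0_integralZl//; last by move=> z _; rewrite lee_fin enorm_ge0.
apply: leeD; last by rewrite (EFinM L) lee_wpmul2l ?lee_fin.
rewrite /moment; apply: ge0_le_integral => //.
- by move=> z _; rewrite lee_fin.
- exact/measurable_EFinP.
- exact/measurable_EFinP.
- move=> x _; rewrite lee_fin; apply: ge0_ler_powR.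
  + exact: le_trans p1.
  + by rewrite nnegrE.
  + by rewrite nnegrE enorm_ge0.
  + by rewrite ge_min lexx.
Qed.

Lemma moment_le_truncated (p rad : R) m : 0 <= p ->
  (forall k : nat, (\int[m]_x (Num.min (enorm x) k%:R `^ p)%:E <= rad%:E)%E) ->
  (moment p m <= rad%:E)%E.
Proof.
move=> p0 hk; rewrite /moment.
pose g (k : nat) (x : E) := (Num.min (enorm x) k%:R `^ p)%:E.
have mg k : measurable_fun setT (g k).
  by apply/measurable_EFinP; exact: measurable_truncated_powR.
have g0 k x : [set: E] x -> (0 <= g k x)%E.
  by move=> _; rewrite lee_fin powR_ge0.
have ndg x : [set: E] x -> {homo g^~ x : k l / (k <= l)%N >-> (k <= l)%E}.
  move=> _ k l kl; rewrite /g lee_fin; apply: ge0_ler_powR => //.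
  + by rewrite nnegrE le_min enorm_ge0/=.
  + by rewrite nnegrE le_min enorm_ge0/=.
  + by rewrite le_min ge_min lexx/= ge_min ler_nat kl orbT.
(* The sequence is constant as soon as [k] exceeds the norm of [x]. *)
have cvg_g x : g^~ x @ \oo --> (enorm x `^ p)%:E.
  apply: cvg_near_cst.
  near=> k; rewrite /g; congr (_ `^ _)%:E; apply/min_idPl.
  by near: k; exact: nbhs_infty_ger.
rewrite (eq_integral (fun x => limn (g^~ x))); last first.
  by move=> x _; rewrite (cvg_lim _ (cvg_g x)).
rewrite monotone_convergence//; apply: lime_le; last by apply: nearW.
apply: ereal_nondecreasing_is_cvgn => k l kl; apply: ge0_le_integral => //.
- by move=> x _; exact: g0.
- by move=> x _; exact: ndg.
Unshelve. all: by end_near. Qed.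

(** Pointwise, |x| is at most 1 + |x|^p, since [1 <= p]. *)
Lemma Bbar_first_moment_le (p rad : R) m : 1 <= p -> Bbar p rad m ->
  (\int[m]_x (enorm x)%:E <= (1 + rad)%:E)%E.
Proof.
move=> p1 [_ mrad].
have mpow : measurable_fun setT (fun x : E => (enorm x `^ p)%:E).
  apply/measurable_EFinP.
  by apply: (measurableT_comp (measurable_powR p)); exact: measurable_fun_enorm.
apply: (@le_trans _ _ (\int[m]_x (cst 1 x + (enorm x `^ p)%:E))%E).
  apply: ge0_le_integral => //.
  - by move=> x _; rewrite lee_fin enorm_ge0.
  - by apply/measurable_EFinP; exact: measurable_fun_enorm.
  - exact: emeasurable_funD.
  - move=> x _; rewrite -EFinD lee_fin.
    have [x1|/ltW x1] := leP (enorm x) 1.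
      by rewrite (le_trans x1)// lerDl powR_ge0.
    by apply: (le_trans (le1r_powR x1 p1)); rewrite lerDr.
rewrite ge0_integralD//; last by move=> x _; rewrite lee_fin powR_ge0.
by rewrite integral_cst// [X in (_ * X)%E](@probability_setT _ _ _ m) mule1 EFinD leeD2l.
Qed.

Lemma d1_closure_Bbar (p rad : R) (A : set (probability E R)) : 1 <= p ->
  A `<=` Bbar p rad -> d1_closure A `<=` Bbar p rad.
Proof.
move=> p1 Ab m [m1 mA].
suff mrad : (moment p m <= rad%:E)%E by split=> //; exact: le_lt_trans mrad (ltry _).
have p0 : 0 <= p by exact: le_trans p1.
apply: moment_le_truncated => // k; apply/lee_addgt0Pr => e e0.
pose L := p * k%:R `^ (p - 1).
have L0 : 0 <= L by rewrite mulr_ge0 ?powR_ge0.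
have L1 : 0 < L + 1 by rewrite ltr_wpDl.
(* The truncation level [k], hence [L], is fixed before the approximating measure is chosen. The
   radius makes the error at most [e]; the added 1 keeps the quotient meaningful when [L = 0]. *)
have [m' [Am' m'1 mm']] := mA (e / (L + 1)) (divr_gt0 e0 L1).
have [pi cpl /ltW pie] := coupling_lt_d1 m1 m'1 mm'.
apply: (le_trans (truncated_moment_le p1 (ler0n _ k) cpl pie)).
have [_ m'rad] := Ab _ Am'.
apply: leeD => //; rewrite lee_fin -/L mulrCA ger_pMr//.
by rewrite ler_pdivrMr// mul1r lerDl.
Qed.

End Moments.

(** * Linear maps on signed measures *)

Section Charges.
Context (R : realType) (n : nat).
Local Notation E := 'rV[R]_n.
Implicit Types (m : probability E R) (mu nu : {charge set E -> \bar R}).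
Implicit Type L : {charge set E -> \bar R} -> R.

(* Leibniz equality would be too strong: charges of the library also carry values on non-measurable
   sets, and mixtures are only specified on measurable ones. *)
Definition eq_charge mu nu := forall A, measurable A -> mu A = nu A.

(** The chosen Hahn decompositions of the two charges may differ, but that of [mu] is also one for
    [nu], and the positive parts of two decompositions of [nu] carry the same charge. *)
Lemma eq_jordan_pos mu nu : eq_charge mu nu ->
  forall A, measurable A ->
    jordan_pos (hahnP mu) A = jordan_pos (hahnP nu) A.
Proof.
move=> munu A mA.
have [[mP _] _ _ _] := hahnP nu; have [[mP' _] _ _ _] := hahnP mu.
have hd : hahn_decomposition nu (hahn_pos mu) (hahn_neg mu).
  have [[m1 p1] [m2 p2] h1 h2] := hahnP mu.
  split=> //; split=> // B mB Bsub; rewrite -munu//; [exact: p1|exact: p2].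
have [posE _] := Hahn_decomposition_uniq hd (hahnP nu) mA.
rewrite !jordan_posE !cjordan_posE /crestr0 !mem_set// /crestr.
by rewrite munu//; exact: measurableI.
Qed.

Lemma eq_jordan_neg mu nu : eq_charge mu nu ->
  forall A, measurable A ->
    jordan_neg (hahnP mu) A = jordan_neg (hahnP nu) A.
Proof.
move=> munu A mA.
have [_ [mP _] _ _] := hahnP nu; have [_ [mP' _] _ _] := hahnP mu.
have hd : hahn_decomposition nu (hahn_pos mu) (hahn_neg mu).
  have [[m1 p1] [m2 p2] h1 h2] := hahnP mu.
  split=> //; split=> // B mB Bsub; rewrite -munu//; [exact: p1|exact: p2].
have [_ negE] := Hahn_decomposition_uniq hd (hahnP nu) mA.
rewrite !jordan_negE !cjordan_negE /crestr0 !mem_set// /crestr.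
by rewrite munu ?negE//; exact: measurableI.
Qed.

Lemma eq_charge_integral mu nu (f : E -> R) : eq_charge mu nu ->
  charge_integral mu f = charge_integral nu f.
Proof.
move=> munu; rewrite /charge_integral; congr (_ - _)%E;
  apply: eq_measure_integral => A mA _;
  [exact: eq_jordan_pos|exact: eq_jordan_neg].
Qed.

Lemma eq_Mhat (p : R) mu nu : eq_charge mu nu -> Mhat p mu -> Mhat p nu.
Proof.
move=> munu [fmu mu0]; split; last by rewrite -munu.
rewrite (_ : moment p _ = moment p (Defs.total_variation mu))//.
apply: eq_measure_integral => A mA _.
by rewrite /= /charge_variation -(eq_jordan_pos munu)// -(eq_jordan_neg munu).
Qed.

Lemma diffpE m1 m2 A : diffp m1 m2 A = (m1 A - m2 A)%E.
Proof. by []. Qed.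

(** On the positive set the variation is m1 - m2, at most m1; on the negative set it is m2 - m1, at
    most m2. *)
Lemma total_variation_diffp_le m1 m2 A : measurable A ->
  (Defs.total_variation (diffp m1 m2) A <= m1 A + m2 A)%E.
Proof.
move=> mA.
have [[mP _] [mN _] _ _] := hahnP (diffp m1 m2).
rewrite /= /charge_variation; apply: leeD.
  rewrite jordan_posE cjordan_posE /crestr0 mem_set// /crestr diffpE.
  apply: (@le_trans _ _ (m1 (A `&` hahn_pos (diffp m1 m2)))).
    by rewrite leeBlDr ?leeDl// fin_num_measure//; exact: measurableI.
  by rewrite le_measure ?inE//; exact: measurableI.
rewrite jordan_negE cjordan_negE /crestr0 mem_set// /crestr diffpE.
have f1 : m1 (A `&` hahn_neg (diffp m1 m2)) \is a fin_num.
  by apply: fin_num_measure; exact: measurableI.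
apply: (@le_trans _ _ (m2 (A `&` hahn_neg (diffp m1 m2)))).
  by rewrite leeNl -[leLHS]add0e leeD2r.
by rewrite le_measure ?inE//; exact: measurableI.
Qed.

Lemma Mhat_diffp (p : R) m1 m2 : Pset p m1 -> Pset p m2 ->
  Mhat p (diffp m1 m2).
Proof.
move=> fm1 fm2; split; last first.
  by rewrite diffpE !probability_setT subee.
have mpow : measurable_fun setT (fun x : E => (enorm x `^ p)%:E).
  apply/measurable_EFinP.
  by apply: (measurableT_comp (measurable_powR p)); exact: measurable_fun_enorm.
apply: (@le_lt_trans _ _
    (\int[measure_add m1 m2]_x (enorm x `^ p)%:E)%E).
  apply: ge0_le_measure_integral => //.
  - move=> A mA; apply: le_trans (total_variation_diffp_le m1 m2 mA) _.
    by rewrite -measure_addE. 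
  - by move=> x; rewrite lee_fin powR_ge0.
rewrite ge0_integral_measure_add//; last by move=> x _; rewrite lee_fin powR_ge0.
exact: lte_add_pinfty.
Qed.

Lemma prob_fineK m A : measurable A -> (fine (m A))%:E = m A.
Proof. by move=> mA; rewrite fineK// fin_num_measure. Qed.

(** Besides linearity, the form must ignore the values of charges on non-measurable sets; this is
    what permits rewriting along mixtures. *)
Definition Mhat_functional (p : R) L :=
  (forall a mu nu, Mhat p mu -> Mhat p nu ->
    L (cadd (cscale a mu) nu) = a * L mu + L nu) /\
  (forall mu nu, Mhat p mu -> Mhat p nu -> eq_charge mu nu -> L mu = L nu).

(** An integral against [phi] only sees the values of the charge on measurable sets. *)
Lemma representative_Mhat_functional (p : R) L phi :
  (forall a mu nu, Mhat p mu -> Mhat p nu ->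
    L (cadd (cscale a mu) nu) = a * L mu + L nu) ->
  representative p L phi -> Mhat_functional p L.
Proof.
move=> linL repL; split=> // mu nu Mmu Mnu munu; apply: EFin_inj.
have [_ ->] := repL _ Mmu; have [_ ->] := repL _ Mnu.
exact: eq_charge_integral.
Qed.

Lemma is_mixP (t : R) m1 m2 m : is_mix t m1 m2 m <->
  forall A, measurable A ->
    fine (m A) = (1 - t) * fine (m1 A) + t * fine (m2 A).
Proof.
split=> mixm A mA.
  by rewrite mixm// -(prob_fineK m1 mA) -(prob_fineK m2 mA) -!EFinM -EFinD.
rewrite -(prob_fineK m mA) -(prob_fineK m1 mA) -(prob_fineK m2 mA) mixm//.
Qed.

Section MhatFunctional.
Variables (p : R) (L : {charge set E -> \bar R} -> R).
Hypothesis LM : Mhat_functional p L.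

Lemma functional_comb a mu nu xi : Mhat p mu -> Mhat p nu ->
  eq_charge (cadd (cscale a mu) nu) xi -> Mhat p xi -> L xi = a * L mu + L nu.
Proof.
move=> Mmu Mnu e Mxi; rewrite -(LM.1 a mu nu)//; apply: LM.2 => //.
  by apply: eq_Mhat Mxi => A mA; rewrite e.
by move=> A mA; rewrite e.
Qed.

(** Reduces every identity between values of [L] at differences of probabilities to a real identity
    on each measurable set, which [ring] can settle. *)
Lemma functional_comb_diffp a m1 m2 m3 m4 m5 m6 :
  Pset p m1 -> Pset p m2 -> Pset p m3 -> Pset p m4 -> Pset p m5 -> Pset p m6 ->
  (forall A, measurable A ->
    a * (fine (m1 A) - fine (m2 A)) + (fine (m3 A) - fine (m4 A)) =
    fine (m5 A) - fine (m6 A)) ->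
  L (diffp m5 m6) = a * L (diffp m1 m2) + L (diffp m3 m4).
Proof.
move=> f1 f2 f3 f4 f5 f6 e.
apply: functional_comb; [exact: Mhat_diffp..| |exact: Mhat_diffp].
move=> A mA.
have dE m m' : diffp m m' A = (fine (m A) - fine (m' A))%:E.
  by rewrite diffpE -{1}(prob_fineK m mA) -{1}(prob_fineK m' mA).
change (a%:E * diffp m1 m2 A + diffp m3 m4 A = diffp m5 m6 A)%E.
by rewrite !dE -EFinM -EFinD e.
Qed.

Lemma functional_diffpp m : Pset p m -> L (diffp m m) = 0.
Proof.
move=> fm; have := @functional_comb_diffp 1 m m m m m m fm fm fm fm fm fm.
have e A : measurable A ->
    1 * (fine (m A) - fine (m A)) + (fine (m A) - fine (m A)) =
    fine (m A) - fine (m A) by move=> _; rewrite !subrr mulr0 addr0.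
by move=> /(_ e); lra.
Qed.

Lemma functional_diffpC m1 m2 : Pset p m1 -> Pset p m2 ->
  L (diffp m1 m2) = - L (diffp m2 m1).
Proof.
move=> f1 f2; rewrite (@functional_comb_diffp (-1) m2 m1 m1 m1 m1 m2)//.
  by rewrite functional_diffpp// mulN1r addr0.
by move=> A mA; ring.
Qed.

(** For the mixture m = (1 - t) m1 + t m2, one has m2 - m = (1 - t) (m2 - m1). *)
Lemma functional_mix_r (t : R) m1 m2 m : Pset p m1 -> Pset p m2 -> Pset p m ->
  is_mix t m1 m2 m -> L (diffp m2 m) = (1 - t) * L (diffp m2 m1).
Proof.
move=> f1 f2 f /is_mixP mixm.
rewrite (@functional_comb_diffp (1 - t) m2 m1 m m m2 m)//.
  by rewrite functional_diffpp// addr0.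
by move=> A mA; rewrite mixm//; ring.
Qed.

Lemma functional_mix_l (t : R) m1 m2 m : Pset p m1 -> Pset p m2 -> Pset p m ->
  is_mix t m1 m2 m -> L (diffp m1 m) = - t * L (diffp m2 m1).
Proof.
move=> f1 f2 f /is_mixP mixm.
rewrite (@functional_comb_diffp (- t) m2 m1 m m m1 m)//.
  by rewrite functional_diffpp// addr0.
by move=> A mA; rewrite mixm//; ring.
Qed.

End MhatFunctional.
End Charges.

(** * Differentiation along segments *)

Section UnitSegment.
Context (R : realType).
Implicit Types f df : R -> R.

(** Differentiability on [0, 1] relative to the segment: one-sided at the end points, and silent
    about [f] outside, where paths of mixtures carry no information. *)
Definition unit_expansion f df := forall t, 0 <= t <= 1 ->
  forall e, 0 < e -> exists2 delta, 0 < delta &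
    forall u, 0 <= u <= 1 -> `|u - t| < delta ->
      `|f u - f t - (u - t) * df t| <= e * `|u - t|.

Lemma unit_expansion_is_derive f df (t : R) : unit_expansion f df -> 0 < t < 1 ->
  is_derive t 1 f (df t).
Proof.
move=> fdf /andP[t0 t1].
have t01 : 0 <= t <= 1 by rewrite !ltW.
have cvgf : h^-1 *: (f (h *: 1 + t) - f t) @[h --> 0^'] --> df t.
  apply/cvgrPdist_le => e e0; have [delta d0 hd] := fdf t t01 e e0.
  near=> h.
  have h0 : h != 0 by near: h; exact: nbhs_dnbhs_neq.
  have hd' : `|h| < delta by near: h; exact: dnbhs0_lt.
  (* Bounding [h] by the distances to 0 and 1 keeps [h + t] inside the unit segment. *)
  have ht : `|h| < t by near: h; exact: dnbhs0_lt.
  have h1t : `|h| < 1 - t by near: h; apply: dnbhs0_lt; rewrite subr_gt0.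
  have u01 : 0 <= h + t <= 1.
    by move: ht h1t; rewrite !ltr_norml => /andP[? ?] /andP[? ?]; apply/andP; split; lra.
  have := hd _ u01; rewrite addrK => /(_ hd') fe.
  rewrite -[X in f X]/(h * 1 + t) mulr1 distrC.
  rewrite -(ler_pM2l (_ : 0 < `|h|)) ?normr_gt0// -normrM mulrBr.
  by rewrite -[h^-1 *: _]/(h^-1 * _) mulVKf// [`|h| * e]mulrC.
have df_ok : derivable f t 1 by apply/cvg_ex; exists (df t).
by apply: DeriveDef => //; apply: cvg_lim.
Unshelve. all: by end_near. Qed.

Lemma unit_expansion_continuous f df : unit_expansion f df ->
  {within `[0, 1], continuous f}.
Proof.
move=> fdf; apply/subspace_continuousP => t /=; rewrite in_itv/= => t01.
apply/cvgrPdist_le => e e0; have [delta d0 hd] := fdf t t01 1 ltr01.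
have K0 : 0 < `|df t| + 1 by rewrite ltr_wpDl.
(* The expansion with tolerance 1 bounds the increment of [f] by [|u - t| * (|df t| + 1)]. *)
have e'0 : 0 < e / (`|df t| + 1) by rewrite divr_gt0.
set e' := e / _ in e'0.
rewrite near_withinE; near=> u; rewrite /= in_itv/= => u01.
have ud : `|u - t| < delta.
  by rewrite distrC; near: u; exact: nbhsx_ballx.
have ue : `|u - t| < e'.
  by rewrite distrC; near: u; exact: nbhsx_ballx.
have := hd u u01 ud; rewrite mul1r => fut.
rewrite distrC (_ : f u - f t = (f u - f t - (u - t) * df t) + (u - t) * df t);
  last by rewrite subrK.
apply: (le_trans (ler_normD _ _)); apply: (le_trans (lerD fut (lexx _))).
rewrite normrM (_ : _ + _ = `|u - t| * (`|df t| + 1)); last by ring.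
by rewrite -ler_pdivlMr// ltW.
Unshelve. all: by end_near. Qed.

(** The increment is [t * df u] for some [u] between 0 and [t], and [df u] differs from [df 0] by at
    most [K * u], hence by at most [K * t]. *)
Lemma unit_expansion_quadratic f df (K t : R) : unit_expansion f df ->
  (forall u, 0 <= u <= 1 -> `|df u - df 0| <= K * u) -> 0 <= t <= 1 ->
  `|f t - f 0 - t * df 0| <= K * t ^+ 2.
Proof.
move=> fdf dfK /andP[t0 t1].
have cont : {within `[0, t], continuous f}.
  apply: continuous_subspaceW (unit_expansion_continuous fdf).
  by apply: subset_itvl; rewrite bnd_simp.
have der u : u \in `]0, t[ -> is_derive u 1 f (df u).
  rewrite in_itv/= => /andP[u0 ut].
  by apply: (unit_expansion_is_derive fdf); rewrite u0 (lt_le_trans ut).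
have [u] := MVT_segment t0 der cont.
rewrite in_itv/= => /andP[u0 ut]; rewrite subr0 => ->.
rewrite [df u * t]mulrC -mulrBr normrM (ger0_norm t0) expr2 mulrCA.
rewrite ler_wpM2l//; have /dfK/le_trans : 0 <= u <= 1.
  by rewrite u0 (le_trans ut).
apply; rewrite ler_wpM2l//.
(* The bound at [u = 1] shows that [K] is nonnegative. *)
have := dfK 1; rewrite ler01 lexx mulr1 => /(_ isT); exact: le_trans.
Qed.

End UnitSegment.

(** * Second-order expansions along mixtures of probability measures *)

Section SecondOrderBound.
Context (R : realType) (n : nat) (p rad : R).
Hypothesis p1 : 1 <= p.
Local Notation E := 'rV[R]_n.
Local Notation prob := (probability E R).
Local Notation B := (Bbar p rad).
Implicit Types (m : prob) (f : prob -> R).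
Implicit Type Df : prob -> {charge set E -> \bar R} -> R.

(** The consequence shared by the assumptions on [F] and [G] when only one direction is used; it
    treats [F] and each coordinate of [G] alike. *)
Definition one_sided_differentiable f Df := forall m m1, B m -> B m1 ->
  forall e, 0 < e -> exists2 xibar : R, 0 < xibar &
    forall (xi : R) m', 0 <= xi <= xibar -> is_mix xi m m1 m' ->
      `|f m' - f m - xi * Df m (diffp m1 m)| <= e * xi.

Definition lipschitz_derivative Df (K1 K2 : R) := forall m1 m2 m3 m4,
  B m1 -> B m2 -> B m3 -> B m4 ->
  `|Df m2 (diffp m4 m3) - Df m1 (diffp m4 m3)| <= K1 * d1 m1 m2 * d1 m3 m4 /\
  `|Df m1 (diffp m4 m3)| <= K2 * d1 m3 m4.

Lemma d1_mix_Bbar_le (t : R) m1 m2 m : 0 <= t <= 1 -> B m1 -> B m2 ->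
  is_mix t m1 m2 m -> d1 m1 m <= t * (2 * (1 + rad)).
Proof.
move=> t01 B1 B2 mixm; apply: (d1_mix_le t01 mixm).
rewrite mulr_natl mulr2n EFinD.
by apply: leeD; exact: (Bbar_first_moment_le p1).
Qed.

Lemma is_mix1 m1 m2 : is_mix 1 m1 m2 m2.
Proof. by apply/is_mixP => A mA; ring. Qed.

Lemma is_mix0 m1 m2 : is_mix 0 m1 m2 m1.
Proof. by apply/is_mixP => A mA; ring. Qed.

Lemma d1_Bbar_le m1 m2 : B m1 -> B m2 -> d1 m1 m2 <= 2 * (1 + rad).
Proof.
move=> B1 B2; rewrite -[leRHS]mul1r; apply: d1_mix_Bbar_le (is_mix1 m1 m2) => //.
by rewrite ler01 lexx.
Qed.

Section Path.
Variables (f : prob -> R) (Df : prob -> {charge set E -> \bar R} -> R).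
Hypothesis fDf : one_sided_differentiable f Df.
Hypothesis Df_functional : forall m, B m -> Mhat_functional p (Df m).
Variables (m mt : prob) (path : R -> prob).
Hypotheses (Bm : B m) (Bmt : B mt).
Hypothesis Bpath : forall t, 0 <= t <= 1 -> B (path t).
Hypothesis mix_path : forall t, 0 <= t <= 1 -> is_mix t m mt (path t).

(** For [u] after [t], [path u] is the mixture of [path t] and [mt] with weight [(u - t) / (1 - t)].
    The direction from [path t] to [mt] is [1 - t] times that from [m] to [mt], so the factors
    cancel; the tolerance is scaled by [1 - t] for the same reason. *)
Lemma path_expansion_right (t e : R) : 0 <= t <= 1 -> 0 < e ->
  exists2 delta, 0 < delta & forall u, t <= u -> u <= 1 -> u - t < delta ->
    `|f (path u) - f (path t) - (u - t) * Df (path t) (diffp mt m)|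
      <= e * (u - t).
Proof.
move=> t01 e0; have /andP[t0 t1] := t01.
have [t_eq1|t_neq1] := eqVneq t 1.
  exists 1 => // u tu u1 _; have -> : u = t by lra.
  by rewrite !subrr mul0r subr0 normr0 mulr0.
have t_lt1 : 0 < 1 - t by rewrite subr_gt0 lt_neqAle t_neq1.
have [xb xb0 hxb] := fDf (Bpath t01) Bmt (mulr_gt0 e0 t_lt1).
exists (xb * (1 - t)); first exact: mulr_gt0.
move=> u tu u1 ut; have u01 : 0 <= u <= 1 by lra.
have xi_ok : 0 <= (u - t) / (1 - t) <= xb.
  by rewrite divr_ge0 ?(ltW t_lt1) ?subr_ge0//= ler_pdivrMr// ltW.
have mix_ut : is_mix ((u - t) / (1 - t)) (path t) mt (path u).
  apply/is_mixP => A mA; move/is_mixP : (mix_path t01) => ->//.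
  move/is_mixP : (mix_path u01) => ->//; field; exact: lt0r_neq0.
have := hxb _ _ xi_ok mix_ut.
rewrite (functional_mix_r (Df_functional (Bpath t01)) Bm.1 Bmt.1 (Bpath t01).1
  (mix_path t01)).
rewrite mulrA divfK ?lt0r_neq0// => /le_trans; apply.
by rewrite -mulrA [(1 - t) * _]mulrC divfK ?lt0r_neq0.
Qed.

(** For [u] before [t], the derivative at [path t] is taken towards [m] instead, with weight
    [(t - u) / t]. *)
Lemma path_expansion_left (t e : R) : 0 <= t <= 1 -> 0 < e ->
  exists2 delta, 0 < delta & forall u, 0 <= u -> u <= t -> t - u < delta ->
    `|f (path u) - f (path t) - (u - t) * Df (path t) (diffp mt m)|
      <= e * (t - u).
Proof.
move=> t01 e0; have /andP[t0 t1] := t01.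
have [t_eq0|t_neq0] := eqVneq t 0.
  exists 1 => // u u0 ut _; have -> : u = t by lra.
  by rewrite !subrr mul0r subr0 normr0 mulr0.
have t_gt0 : 0 < t by rewrite lt0r t_neq0.
have [xb xb0 hxb] := fDf (Bpath t01) Bm (mulr_gt0 e0 t_gt0).
exists (xb * t); first exact: mulr_gt0.
move=> u u0 ut tu; have u01 : 0 <= u <= 1 by lra.
have xi_ok : 0 <= (t - u) / t <= xb.
  by rewrite divr_ge0 ?subr_ge0//= ler_pdivrMr// ltW.
have mix_ut : is_mix ((t - u) / t) (path t) m (path u).
  apply/is_mixP => A mA; move/is_mixP : (mix_path t01) => ->//.
  by move/is_mixP : (mix_path u01) => ->//; field.
have := hxb _ _ xi_ok mix_ut.
rewrite (functional_mix_l (Df_functional (Bpath t01)) Bm.1 Bmt.1 (Bpath t01).1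
  (mix_path t01)).
rewrite mulNr mulrN mulrA divfK// -mulNr opprB => /le_trans; apply.
by rewrite -mulrA [t * _]mulrC divfK.
Qed.

Lemma path_unit_expansion :
  unit_expansion (f \o path) (fun t => Df (path t) (diffp mt m)).
Proof.
move=> t t01 e e0.
have [dr dr0 hr] := path_expansion_right t01 e0.
have [dl dl0 hl] := path_expansion_left t01 e0.
exists (Num.min dr dl) => [|u /andP[u0 u1]]; first by rewrite lt_min dr0.
rewrite lt_min => /andP[udr udl] /=.
have [tu|/ltW ut] := leP t u.
  rewrite ger0_norm ?subr_ge0// in udr *; exact: hr.
have normE : `|u - t| = t - u by rewrite distrC ger0_norm ?subr_ge0.
by rewrite normE in udl *; exact: hl.
Qed.

End Path.

Lemma second_order_bound f Df (K1 K2 : R) (C : set prob) m mt m' (t : R) :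
  one_sided_differentiable f Df ->
  (forall m, B m -> Mhat_functional p (Df m)) ->
  0 <= K1 -> lipschitz_derivative Df K1 K2 ->
  mix_convex C -> C `<=` B -> C m -> C mt -> 0 <= t <= 1 ->
  is_mix t m mt m' ->
  `|f m' - f m - t * Df m (diffp mt m)| <= K1 * (2 * (1 + rad)) ^+ 2 * t ^+ 2.
Proof.
move=> fDf DfL K10 lip convC CB Cm Cmt t01 mixm'.
(* [xget] makes the path total; at 0 it is forced to be [m] itself, and outside [0, 1] its value is
   irrelevant. *)
pose path (u : R) : prob := if u == 0 then m else xget m (is_mix u m mt).
have mix_path u : 0 <= u <= 1 -> is_mix u m mt (path u).
  rewrite /path; have [->|_ u01] := eqVneq u 0; first by move=> _; exact: is_mix0.
  apply: (@xgetPex _ m (is_mix u m mt)).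
  by exists (mixture u01 m mt : prob) => A mA; exact: mixtureE.
have Bpath u : 0 <= u <= 1 -> B (path u).
  by move=> u01; apply: CB; exact: (convC u m mt) (mix_path u u01).
have path0 : path 0 = m by rewrite /path eqxx.
have Bm := CB _ Cm; have Bmt := CB _ Cmt.
(* Two mixtures with the same weight agree on measurable sets without being equal. Each is a mixture
   of the other with weight 0, and differentiability at [xi = 0] shows that [f] does not separate
   them. *)
have -> : f m' = f (path t).
  apply/eqP; rewrite -subr_eq0 -normr_le0.
  have [xb xb0] := fDf _ m (Bpath t t01) Bm 1 ltr01.
  move=> /(_ 0 m'); rewrite lexx (ltW xb0) mul0r subr0 mulr0; apply => //.
  apply/is_mixP => A mA; move/is_mixP : mixm' => ->//.
  by move/is_mixP : (mix_path t t01) => ->//; ring.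
have pe := path_unit_expansion fDf DfL Bm Bmt Bpath mix_path.
have := unit_expansion_quadratic pe _ t01; rewrite /= path0; apply => u u01.
have [+ _] := lip m (path u) m mt Bm (Bpath u u01) Bm Bmt.
move=> /le_trans; apply.
have d1u := d1_mix_Bbar_le u01 Bm Bmt (mix_path u u01).
have d1mt := d1_Bbar_le Bm Bmt.
rewrite -!mulrA ler_wpM2l//.
(* One distance is at most [u] times the diameter bound, the other at most that bound itself. *)
apply: le_trans (ler_pM (d1_ge0 _ _) (d1_ge0 _ _) d1u d1mt) _.
by rewrite le_eqVlt; apply/orP; left; apply/eqP; ring.
Qed.

Lemma derivative_bound Df (K1 K2 : R) m mt : 0 <= K2 ->
  lipschitz_derivative Df K1 K2 -> B m -> B mt ->
  `|Df m (diffp mt m)| <= K2 * (2 * (1 + rad)).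
Proof.
move=> K20 lip Bm Bmt; have [_ +] := lip m m m mt Bm Bm Bm Bmt.
by move=> /le_trans; apply; rewrite ler_wpM2l// d1_Bbar_le.
Qed.

End SecondOrderBound.

(** * The augmented Lagrangian and the projected gradient step *)

Section ProjectedStep.
Context (R : realType).
Implicit Types s delta t : R.

Lemma projected_step_le s delta t : 0 <= s -> 0 <= t <= 1 ->
  `|Num.max (s + t * delta) 0 - s| <= t * `|delta|.
Proof.
move=> s0 /andP[t0 t1].
have [h|h] := leP (s + t * delta) 0.
  have td : s <= - (t * delta) by lra.
  rewrite sub0r normrN ger0_norm// (le_trans td)// -mulrN ler_wpM2l//.
  by rewrite -normrN ler_norm.
by rewrite addrAC subrr add0r normrM (ger0_norm t0).
Qed.

(** First-order decrease along the projected path when the gradient is [- delta]. The cases record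
    whether the projection is active at the full step and at step [t]. *)
Lemma projected_step_descent s delta t : 0 <= s -> 0 <= t <= 1 ->
  - delta * (Num.max (s + t * delta) 0 - s) <=
  - t * (s - Num.max (s + delta) 0) ^+ 2.
Proof.
move=> s0 /andP[t0 t1].
have [h|h] := leP (s + delta) 0; have [h'|h'] := leP (s + t * delta) 0.
- have : 0 <= s * (- delta - s) by apply: mulr_ge0; lra.
  have : 0 <= (1 - t) * s ^+ 2 by apply: mulr_ge0; [lra|exact: sqr_ge0].
  by nra.
- have : 0 <= t * ((- delta - s) * (- delta + s)).
    by apply: mulr_ge0 => //; apply: mulr_ge0; lra.
  by nra.
(* Here [s + t * delta] is a convex combination of [s + delta > 0] and [s >= 0]; being nonpositive,
   it forces [t = 0] and [s = 0]. *)
- have ts : 0 <= t * (s + delta) by rewrite mulr_ge0// ltW.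
  have t1s : 0 <= (1 - t) * s by rewrite mulr_ge0// subr_ge0.
  have /eqP : t * (s + delta) = 0 by lra.
  rewrite mulf_eq0 (gt_eqF h) orbF => /eqP t_eq0; subst t.
  have -> : s = 0 by lra.
  by rewrite subrr mulr0 oppr0 mul0r.
- by nra.
Qed.

(** Contribution of one coordinate: [y] is the multiplier, [g] the change of the constraint and [a]
    that of constraint plus slack. The linear term uses the expansion of [g] and the projected
    descent; the quadratic one uses that [a] is of order [t]. *)
Lemma augmented_coord_step (y g dg s c t B kappa kappa' a : R) :
  0 <= s -> 0 <= t <= 1 -> 0 < c -> 0 <= kappa -> 0 <= kappa' ->
  `|y| <= B -> `|g - t * dg| <= kappa * t ^+ 2 -> `|dg| <= kappa' ->
  a = g + (Num.max (s + t * - y) 0 - s) ->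
  y * a + c / 2 * a ^+ 2 <=
    t * (y * dg) - t * (s - Num.max (s + - y) 0) ^+ 2
    + (B * kappa + c / 2 * (kappa' + kappa + B) ^+ 2) * t ^+ 2.
Proof.
move=> s0 t01 c0 k0 k'0 yB gk dgk; have /andP[t0 t1] := t01.
have := projected_step_descent (- y) s0 t01.
have := projected_step_le (- y) s0 t01.
rewrite opprK normrN; set q := Num.max _ _ - s => qt yq aE.
have B0 : 0 <= B by exact: le_trans yB.
have yg : y * g <= t * (y * dg) + B * kappa * t ^+ 2.
  have : y * (g - t * dg) <= B * (kappa * t ^+ 2).
    by rewrite (le_trans (ler_norm _))// normrM ler_pM.
  lra.
(* Turns the second-order error on [g] into a term linear in [t]. *)
have t2 : t ^+ 2 <= t by rewrite expr2 ler_piMr.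
have at_le : `|a| <= t * (kappa' + kappa + B).
  rewrite aE -[g](subrK (t * dg)).
  apply: (le_trans (ler_normD _ _)); rewrite mulrDr; apply: lerD.
    apply: (le_trans (ler_normD _ _)); rewrite mulrDr addrC; apply: lerD.
      by rewrite normrM ger0_norm// ler_wpM2l.
    by apply: (le_trans gk); rewrite mulrC ler_wpM2r.
  by apply: (le_trans qt); rewrite ler_wpM2l.
have a2 : a ^+ 2 <= (kappa' + kappa + B) ^+ 2 * t ^+ 2.
  rewrite -exprMn -real_normK ?num_real//.
  rewrite ler_pXn2r ?nnegrE//; first by rewrite mulrC.
  by rewrite mulr_ge0// !addr_ge0.
have ca2 : c / 2 * a ^+ 2 <= c / 2 * ((kappa' + kappa + B) ^+ 2 * t ^+ 2).
  by rewrite ler_wpM2l// divr_ge0// ltW.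
rewrite {1}aE; lra.
Qed.

End ProjectedStep.

(** * The augmented Lagrangian as a quadratic function of constraint plus slack *)

Section AugmentedLagrangian.
Context (R : realType) (n N : nat).
Local Notation prob := (probability 'rV[R]_n R).
Variables (F : prob -> R) (G : prob -> 'rV[R]_N).
Implicit Types (m : prob) (s lambda : 'rV[R]_N) (c : R).

Lemma LAE m s lambda c : LA F G m s lambda c = F m +
  \sum_i (lambda 0 i * (G m + s) 0 i + c / 2 * (G m + s) 0 i ^+ 2).
Proof. by rewrite /LA sqr_enorm big_split/= -mulr_sumr addrA. Qed.

(** Apart from [F], the function is quadratic in [G m + s], so its Taylor expansion is exact, with
    the multiplier as gradient. *)
Lemma LA_sub m s m' s' lambda c :
  LA F G m' s' lambda c - LA F G m s lambda c = F m' - F m +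
  \sum_i ((lambda + c *: (G m + s)) 0 i *
            (G m' 0 i - G m 0 i + (s' 0 i - s 0 i)) +
          c / 2 * (G m' 0 i - G m 0 i + (s' 0 i - s 0 i)) ^+ 2).
Proof.
rewrite !LAE opprD addrACA -sumrB; congr (_ + _).
by apply: eq_bigr => i _; rewrite !mxE; field.
Qed.

(** Completing the square. It serves twice: an upper bound on [LA] bounds the multiplier, and a
    lower bound on [F] bounds [LA] below. *)
Lemma sum_sqr_multiplier m s lambda c :
  \sum_i (lambda + c *: (G m + s)) 0 i ^+ 2 =
  2 * c * (LA F G m s lambda c - F m) + \sum_i lambda 0 i ^+ 2.
Proof.
rewrite LAE addrAC subrr add0r mulr_sumr -big_split/=.
by apply: eq_bigr => i _; rewrite !mxE; field.
Qed.

End AugmentedLagrangian.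

(** * Termination *)

(** The hypothesis [0 <= x] covers the initial value 0 of the iterated maximum. *)
Lemma supnorm_gt (R : realType) N (v : 'rV[R]_N) (x : R) : 0 <= x ->
  x < supnorm v -> exists i, x < `|v 0 i|.
Proof.
move=> x0 xv; apply: contrapT => /forallNP h; move: xv; apply/negP.
rewrite -leNgt /supnorm; elim/big_ind: _ => [//|a b ax bx|i _].
  by rewrite ge_max ax.
by rewrite leNgt; apply/negP; exact: h.
Qed.

Section Termination.
Context (R : realType) (n N : nat).
Local Notation prob := (probability 'rV[R]_n R).
Variables (C : set prob) (F : prob -> R) (G : prob -> 'rV[R]_N).
Variables (DF : prob -> {charge set 'rV[R]_n -> \bar R} -> R).
Variables (DG : prob -> {charge set 'rV[R]_n -> \bar R} -> 'rV[R]_N).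
Variables (kappa kappa' Fmin : R).
Hypothesis convC : mix_convex C.
Hypothesis F_expansion : forall m mt m' (t : R), C m -> C mt -> 0 <= t <= 1 ->
  is_mix t m mt m' ->
  `|F m' - F m - t * DF m (diffp mt m)| <= kappa * t ^+ 2.
Hypothesis G_expansion : forall i m mt m' (t : R), C m -> C mt -> 0 <= t <= 1 ->
  is_mix t m mt m' ->
  `|G m' 0 i - G m 0 i - t * DG m (diffp mt m) 0 i| <= kappa * t ^+ 2.
Hypothesis DG_bound : forall i m mt, C m -> C mt ->
  `|DG m (diffp mt m) 0 i| <= kappa'.
Hypothesis F_ge : forall m, C m -> Fmin <= F m.
Hypothesis DF_opp : forall m mt, C m -> C mt ->
  DF m (diffp m mt) = - DF m (diffp mt m).
Hypothesis DG_opp : forall i m mt, C m -> C mt ->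
  DG m (diffp m mt) 0 i = - DG m (diffp mt m) 0 i.
Hypotheses (kappa_ge0 : 0 <= kappa) (kappa'_ge0 : 0 <= kappa').
Variables (lambda : 'rV[R]_N) (c omega : R).
Hypotheses (c_gt0 : 0 < c) (omega_gt0 : 0 < omega).

Local Notation LA := (LA F G).
Local Notation DLA := (DLA G DF DG).
Local Notation delta_s := (delta_s G).
Local Notation multiplier m s := (lambda + c *: (G m + s)).

Lemma DLA_opp m mt (s : 'rV[R]_N) : C m -> C mt ->
  DLA m s lambda c (diffp m mt) = - DLA m s lambda c (diffp mt m).
Proof.
move=> Cm Cmt; rewrite /Defs.DLA DF_opp// opprD; congr (_ + _).
by rewrite /dotv -sumrN; apply: eq_bigr => i _; rewrite DG_opp// mulrN.
Qed.

(** The current point competes in the linear problem with value 0, as that value is its own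
    opposite. *)
Lemma direction_step_le0 m mt (s : 'rV[R]_N) : C m ->
  direction_step C G DF DG m mt s lambda c ->
  DLA m s lambda c (diffp mt m) <= 0.
Proof.
move=> Cm [Cmt /(_ m Cm)/le_trans]; apply.
have := @DLA_opp m m s Cm Cm; lra.
Qed.

(** Both terms on the left are nonpositive. If the duality gap exceeds [omega], the first suffices;
    otherwise some coordinate of the slack residual exceeds [omega], and its square gives
    [omega ^+ 2]. *)
Lemma criterion_descent m mt (s : 'rV[R]_N) : C m ->
  direction_step C G DF DG m mt s lambda c ->
  omega < criterion G DF DG m mt s lambda c ->
  DLA m s lambda c (diffp mt m) -
  \sum_i (s 0 i - Num.max (s 0 i + - multiplier m s 0 i) 0) ^+ 2 <=
  - Num.min omega (omega ^+ 2).
Proof.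
move=> Cm dir; have := direction_step_le0 Cm dir; have [Cmt _] := dir.
rewrite /criterion lt_max DLA_opp//; set D := DLA _ _ _ _ _; set S := \sum_i _.
have S0 : 0 <= S by apply: sumr_ge0 => i _; exact: sqr_ge0.
move=> D0 /orP[oD|/(supnorm_gt (ltW omega_gt0))[i]].
  have : Num.min omega (omega ^+ 2) <= omega by rewrite ge_min lexx.
  lra.
rewrite /Defs.delta_s !mxE => oi.
suff oS : omega ^+ 2 <= S.
  have : Num.min omega (omega ^+ 2) <= omega ^+ 2 by rewrite ge_min lexx orbT.
  lra.
rewrite /S (bigD1 i)//= ler_wpDr//.
  by apply: sumr_ge0 => j _; exact: sqr_ge0.
rewrite !mxE -[leRHS]real_normK ?num_real// ler_pXn2r ?nnegrE ?(ltW omega_gt0)//.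
exact: ltW.
Qed.

Definition curvature (B : R) :=
  kappa + N%:R * (B * kappa + c / 2 * (kappa' + kappa + B) ^+ 2).

Lemma LA_step_le (B : R) m mt m' (s : 'rV[R]_N) (t : R) : C m -> (forall i, 0 <= s 0 i) ->
  (forall i, `|multiplier m s 0 i| <= B) ->
  direction_step C G DF DG m mt s lambda c ->
  omega < criterion G DF DG m mt s lambda c ->
  0 <= t <= 1 -> is_mix t m mt m' ->
  LA m' (vpos (s + t *: delta_s m s lambda c)) lambda c <=
  LA m s lambda c - t * Num.min omega (omega ^+ 2) + curvature B * t ^+ 2.
Proof.
move=> Cm s0 yB dir crit t01 mixm'; have [Cmt _] := dir.
have /andP[t0 _] := t01.
have desc := criterion_descent Cm dir crit.
have {}desc := ler_wpM2l t0 desc.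
have Fle : F m' - F m <= t * DF m (diffp mt m) + kappa * t ^+ 2.
  have := le_trans (ler_norm _) (F_expansion Cm Cmt t01 mixm'); lra.
set s' := vpos _; have s'E i : s' 0 i =
    Num.max (s 0 i + t * - multiplier m s 0 i) 0 by rewrite !mxE.
pose K := B * kappa + c / 2 * (kappa' + kappa + B) ^+ 2.
have sumle : \sum_i (multiplier m s 0 i *
          (G m' 0 i - G m 0 i + (s' 0 i - s 0 i)) +
        c / 2 * (G m' 0 i - G m 0 i + (s' 0 i - s 0 i)) ^+ 2) <=
    \sum_i (t * (multiplier m s 0 i * DG m (diffp mt m) 0 i) -
      t * (s 0 i - Num.max (s 0 i + - multiplier m s 0 i) 0) ^+ 2 +
      K * t ^+ 2).
  apply: ler_sum => i _; apply: (@augmented_coord_step _ _ (G m' 0 i - G m 0 i)) => //.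
  - exact: G_expansion.
  - exact: DG_bound.
  - by rewrite s'E.
move: sumle; rewrite [leRHS]big_split/= [X in _ <= X + _ -> _]sumrB.
rewrite [X in _ <= X - _ + _ -> _](esym (mulr_sumr _ _ _ _)).
rewrite [X in _ <= _ - X + _ -> _](esym (mulr_sumr _ _ _ _)).
rewrite [X in _ <= _ + X -> _]sumr_const card_ord -(mulr_natl (K * _)) => sumle.
have LAB := LA_sub F G m s m' s' lambda c.
rewrite /Defs.DLA /dotv in desc.
rewrite /curvature -/K; lra.
Qed.

Variables (m mt : nat -> prob) (s : nat -> 'rV[R]_N) (theta : nat -> R).
Hypotheses (Cm0 : C (m 0%N)) (s0_ge0 : forall i, 0 <= s 0%N 0 i).

Lemma projected_gradient_terminates :
  algorithm_run C F G DF DG (m 0%N) (s 0%N) lambda c omega m mt s theta ->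
  exists l : nat, criterion G DF DG (m l) (mt l) (s l) lambda c <= omega.
Proof.
move=> [_ _ dir upd]; apply: contrapT => /forallNP notle.
(* If the test never succeeds, the constraints of the run hold at every index. *)
have cont l : omega < criterion G DF DG (m l) (mt l) (s l) lambda c.
  by rewrite ltNge; apply/negP; exact: notle.
have {}dir l := dir l (fun j _ => cont j).
have {}upd l := upd l (fun j _ => cont j).
pose V := 2 * c * (LA (m 0%N) (s 0%N) lambda c - Fmin)
  + \sum_i lambda 0 i ^+ 2.
(* Since [V] bounds the squared multiplier as long as [LA] stays below its initial value, [1 + |V|]
   bounds its absolute value, uniformly in the iterate and without a square root. *)
pose B := 1 + `|V|.
have yB l i : C (m l) ->
    LA (m l) (s l) lambda c <= LA (m 0%N) (s 0%N) lambda c ->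
    `|multiplier (m l) (s l) 0 i| <= B.
  move=> Cml LAl.
  have : multiplier (m l) (s l) 0 i ^+ 2 <= V.
    apply: (@le_trans _ _ (\sum_j multiplier (m l) (s l) 0 j ^+ 2)).
      rewrite (bigD1 i)//= lerDl; apply: sumr_ge0 => j _; exact: sqr_ge0.
    rewrite (sum_sqr_multiplier F) lerD2r ler_wpM2l ?mulr_ge0 ?(ltW c_gt0)//.
    by have := F_ge Cml; lra.
  move=> /le_trans/(_ (ler_norm V)); rewrite -real_normK ?num_real// /B.
  set y := `|_|; set v := `|V|; have : 0 <= (y - 1) ^+ 2 by exact: sqr_ge0.
  have : 0 <= v by exact: normr_ge0.
  by rewrite sqrrB1; nra.
pose eta := Num.min omega (omega ^+ 2).
have eta0 : 0 < eta by rewrite lt_min omega_gt0 exprn_gt0.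
have B0 : 0 <= B by rewrite addr_ge0.
have M0 : 0 <= curvature B.
  have c2 : 0 <= c / 2 by rewrite divr_ge0 ?(ltW c_gt0).
  apply: addr_ge0 => //; apply: mulr_ge0 => //.
  by apply: addr_ge0; apply: mulr_ge0; rewrite ?sqr_ge0.
(* This trial step is at most 1/2 and makes the quadratic error at most half of the linear gain,
   leaving a net decrease of [t * eta / 2]. *)
pose t := eta / (2 * (curvature B + eta)).
have Me0 : 0 < 2 * (curvature B + eta) by rewrite mulr_gt0// ltr_wpDl.
have t01 : 0 <= t <= 1.
  by rewrite divr_ge0 ?(ltW eta0) ?(ltW Me0)//= ler_pdivrMr// mul1r; lra.
have t0 : 0 < t by exact: divr_gt0.
have tM : curvature B * t <= eta / 2.
  rewrite /t mulrA ler_pdivrMr// (_ : eta / 2 * _ = (curvature B + eta) * eta);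
    last by field.
  by rewrite ler_wpM2r ?ltW//; lra.
have step l : C (m l) -> (forall i, 0 <= s l 0 i) ->
    LA (m l) (s l) lambda c <= LA (m 0%N) (s 0%N) lambda c ->
    [/\ C (m l.+1), forall i, 0 <= s l.+1 0 i &
      LA (m l.+1) (s l.+1) lambda c <=
        LA (m l) (s l) lambda c - t * eta / 2].
  move=> Cml sl LAl; have [Cmt _] := dir l.
  have [th01 mixl sE minl] := upd l; split.
  - exact: convC mixl.
  - by move=> i; rewrite sE !mxE le_max lexx orbT.
  (* The exact line search does at least as well as the trial step [t]. *)
  - apply: (le_trans (minl t (mixture t01 (m l) (mt l) : prob) t01 _)).
      by move=> A mA; exact: mixtureE.
    have mixt : is_mix t (m l) (mt l) (mixture t01 (m l) (mt l) : prob).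
      by move=> A mA; exact: mixtureE.
    apply: (le_trans (LA_step_le Cml sl (fun i => yB l i Cml LAl) (dir l)
      (cont l) t01 mixt)).
    have : t * (curvature B * t) <= t * (eta / 2) by rewrite ler_wpM2l ?(ltW t0).
    rewrite -/eta; lra.
have te0 : 0 < t * eta / 2 by rewrite divr_gt0// mulr_gt0.
(* The three facts go together: the decrease keeps the multiplier below [B], which the next step
   requires. *)
have inv l : [/\ C (m l), forall i, 0 <= s l 0 i &
    LA (m l) (s l) lambda c <=
      LA (m 0%N) (s 0%N) lambda c - l%:R * (t * eta / 2)].
  elim: l => [|l [Cml sl LAl]]; first by split=> //; rewrite mul0r subr0.
  have [] := step l Cml sl.
    by apply: (le_trans LAl); rewrite gerBl mulr_ge0// ltW.
  by move=> ? ? ?; split=> //; rewrite mulrSr mulrDl mul1r; lra.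
have LA_ge l : 0 <= 2 * c * (LA (m l) (s l) lambda c - Fmin)
    + \sum_i lambda 0 i ^+ 2.
  have [Cml _ _] := inv l.
  apply: (@le_trans _ _ (\sum_i multiplier (m l) (s l) 0 i ^+ 2)).
    by apply: sumr_ge0 => i _; exact: sqr_ge0.
  rewrite (sum_sqr_multiplier F) lerD2r ler_wpM2l ?mulr_ge0 ?(ltW c_gt0)//.
  by have := F_ge Cml; lra.
have ce0 : 0 < 2 * c * (t * eta / 2) by apply: mulr_gt0 => //; exact: mulr_gt0.
(* By the Archimedean property, the accumulated decrease eventually exceeds what the lower bound
   [LA_ge] allows. *)
have [l] : exists l : nat, V < l%:R * (2 * c * (t * eta / 2)).
  exists (Num.bound `|V / (2 * c * (t * eta / 2))|).
  rewrite -ltr_pdivrMr//; apply: (le_lt_trans (ler_norm _)).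
  exact: archi_boundP.
have [_ _ LAl] := inv l; have := LA_ge l.
have c20 : 0 <= 2 * c by rewrite mulr_ge0 ?(ltW c_gt0).
have := ler_wpM2l c20 LAl.
rewrite /V; lra.
Qed.

End Termination.

(** * From the differentiability assumptions on [F] and [G] to one-sided derivatives *)

Section Differentiability.
Context (R : realType) (n N : nat) (p rad : R).
Local Notation E := 'rV[R]_n.
Local Notation prob := (probability E R).
Variables (F : prob -> R) (G : prob -> 'rV[R]_N).
Variables (DF : prob -> {charge set E -> \bar R} -> R).
Variables (DG : prob -> {charge set E -> \bar R} -> 'rV[R]_N).

Lemma is_mix_mix3 (xi : R) (m m1 m' : prob) :
  is_mix xi m m1 m' -> is_mix3 xi 0 m m1 m1 m'.
Proof. by move=> mixm A mA; rewrite mixm// subr0 mul0e adde0. Qed.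

Lemma differentiable_F_one_sided : differentiable_F p rad F DF ->
  one_sided_differentiable p rad F DF.
Proof.
move=> hF m m1 Bm Bm1 e e0; have [_ dF _] := hF m Bm.
have [xib [zb [/andP[xib0 _] /andP[zb0 _] _ h]]] := dF m1 m1 Bm1 Bm1 e e0.
exists xib => // xi m' xi01 mixm'.
have := h xi 0 m' xi01; rewrite lexx (ltW zb0) mul0r subr0 addr0; apply=> //.
exact: is_mix_mix3.
Qed.

Lemma differentiable_F_functional m : differentiable_F p rad F DF ->
  Bbar p rad m -> Mhat_functional p (DF m).
Proof.
move=> hF /hF[linF _ [phi [_ _ repF]]].
exact: representative_Mhat_functional repF.
Qed.

Lemma strictly_differentiable_G_one_sided i :
  strictly_differentiable_G p rad G DG ->
  one_sided_differentiable p rad (fun m => G m 0 i) (fun m mu => DG m mu 0 i).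
Proof.
move=> hG m m1 Bm Bm1 e e0; have [_ dG _] := hG m Bm.
have [xib [zb [/andP[xib0 _] /andP[zb0 _] _ h]]] := dG m1 m1 Bm1 Bm1 e e0.
exists xib => // xi m' xi01 mixm'.
(* Strict differentiability is used with the first of the two points equal to the base point [m]. *)
have := h 0 xi 0 0 m m'; rewrite !lexx (ltW xib0) (ltW zb0).
have mix3 := is_mix_mix3 (is_mix0 m m1).
move=> /(_ isT xi01 isT isT mix3 (is_mix_mix3 mixm')).
rewrite !subr0 scale0r subr0 normr0 addr0.
have /andP[xi0 _] := xi01; rewrite (ger0_norm xi0); apply: le_trans.
by have := ler_coord_enorm (G m' - G m - xi *: DG m (diffp m1 m)) i; rewrite !mxE.
Qed.

Lemma strictly_differentiable_G_functional i m :
  strictly_differentiable_G p rad G DG -> Bbar p rad m ->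
  Mhat_functional p (fun mu => DG m mu 0 i).
Proof.
move=> hG /hG[linG _ [phi [_ _ repG]]].
apply: representative_Mhat_functional (repG i) => a mu nu Mmu Mnu.
by rewrite linG// !mxE.
Qed.

End Differentiability.

Theorem proposition22
  (R : realType) (n nW k N : nat)
  (d : measure_display) (Omega : measurableType d) (P : probability Omega R)
  (T : R) (hT : 0 < T)
  (W : R -> Omega -> 'rV[R]_nW) (hW : brownian_motion P T W)
  (U : set 'rV[R]_k) (hU : compact U)
  (Y0 : Omega -> 'rV[R]_n) (mY0 : measurable_fun setT Y0)
  (hY0 : independent_of_noise P T Y0 W)
  (b : 'rV[R]_n -> 'rV[R]_k -> 'rV[R]_n)
  (sigma : 'rV[R]_n -> 'rV[R]_k -> 'M[R]_(n, nW))
  (hbs : sde_coefficients U b sigma)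
  (p : R) (hp : 2 <= p)
  (hmom : (moment p (pushforward P Y0) < +oo)%E)
  (rad : R) (hrad : 0 < rad)
  (hreach : reachable P T U b sigma W Y0 `<=` Bbar p rad)
  (hconv : mix_convex (d1_closure (reachable P T U b sigma W Y0)))
  (hcomp : d1_compact (d1_closure (reachable P T U b sigma W Y0)))
  (F : probability 'rV[R]_n R -> R)
  (G : probability 'rV[R]_n R -> 'rV[R]_N)
  (cF : d1_continuous_on (Bbar p rad) (V := R) Num.norm F)
  (cG : d1_continuous_on (Bbar p rad) (@enorm R 1 N) G)
  (DF : probability 'rV[R]_n R -> {charge set 'rV[R]_n -> \bar R} -> R)
  (DG : probability 'rV[R]_n R -> {charge set 'rV[R]_n -> \bar R} -> 'rV[R]_N)
  (hF : differentiable_F p rad F DF)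
  (hG : strictly_differentiable_G p rad G DG)
  (hLip : lipschitz_derivatives p rad DF DG)
  (minit : probability 'rV[R]_n R)
  (hminit : d1_closure (reachable P T U b sigma W Y0) minit)
  (sinit : 'rV[R]_N) (hsinit : forall i, 0 <= sinit 0 i)
  (lambda : 'rV[R]_N) (c : R) (hc : 0 < c) (omega : R) (homega : 0 < omega)
  (m mt : nat -> probability 'rV[R]_n R) (s : nat -> 'rV[R]_N)
  (theta : nat -> R)
  (hrun : algorithm_run (d1_closure (reachable P T U b sigma W Y0)) F G DF DG
            minit sinit lambda c omega m mt s theta) :
  exists l : nat, criterion G DF DG (m l) (mt l) (s l) lambda c <= omega.
Proof.
have p1 : 1 <= p by apply: le_trans hp; rewrite ler1n.
have [m0E s0E _ _] := hrun; subst minit sinit.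
set C := d1_closure _ in hconv hcomp hminit hrun.
have CB : C `<=` Bbar p rad by exact: d1_closure_Bbar.
have [K1 [K2 [K1_gt0 K2_gt0 lip]]] := hLip.
have lipF : lipschitz_derivative p rad DF K1 K2.
  by move=> m1 m2 m3 m4 B1 B2 B3 B4; have [] := lip _ _ _ _ B1 B2 B3 B4.
have lipG i : lipschitz_derivative p rad (fun m mu => DG m mu 0 i) K1 K2.
  move=> m1 m2 m3 m4 B1 B2 B3 B4; have [_ lipG1 _ lipG2] := lip _ _ _ _ B1 B2 B3 B4.
  split; last exact: le_trans (ler_coord_enorm _ _) lipG2.
  apply: le_trans lipG1.
  by have := ler_coord_enorm (DG m2 (diffp m4 m3) - DG m1 (diffp m4 m3)) i;
    rewrite !mxE.
(* Bound on the [d1]-diameter of the moment ball. *)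
pose D := 2 * (1 + rad).
have D0 : 0 <= D by rewrite mulr_ge0// addr_ge0// ltW.
have DF_functional m' := @differentiable_F_functional _ _ _ _ _ _ m' hF.
have DG_functional i m' :=
  @strictly_differentiable_G_functional _ _ _ _ _ _ _ i m' hG.
have expF m' mt' m'' (t : R) : C m' -> C mt' -> 0 <= t <= 1 -> is_mix t m' mt' m'' ->
    `|F m'' - F m' - t * DF m' (diffp mt' m')| <= K1 * D ^+ 2 * t ^+ 2.
  exact: (second_order_bound p1 (differentiable_F_one_sided hF) DF_functional
    (ltW K1_gt0) lipF hconv CB).
have expG i m' mt' m'' (t : R) : C m' -> C mt' -> 0 <= t <= 1 -> is_mix t m' mt' m'' ->
    `|G m'' 0 i - G m' 0 i - t * DG m' (diffp mt' m') 0 i| <=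
    K1 * D ^+ 2 * t ^+ 2.
  exact: (second_order_bound p1 (strictly_differentiable_G_one_sided i hG)
    (DG_functional i) (ltW K1_gt0) (lipG i) hconv CB).
(* The lower bound on [F] comes from its expansion at [t = 1] from the initial point: the linear
   term is at most [K2 * D] and the remainder at most [K1 * D ^+ 2]. *)
apply: (@projected_gradient_terminates R n N C F G DF DG (K1 * D ^+ 2) (K2 * D)
  (F (m 0%N) - K1 * D ^+ 2 - K2 * D)) hrun => //.
- move=> i m' mt' Cm' Cmt'.
  exact: (derivative_bound p1 (ltW K2_gt0) (lipG i) (CB _ Cm') (CB _ Cmt')).
- move=> m' Cm'.
  have := expF _ _ _ 1 hminit Cm'; rewrite ler01 lexx => /(_ m' isT (is_mix1 _ _)).
  have := derivative_bound p1 (ltW K2_gt0) lipF (CB _ hminit) (CB _ Cm').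
  by rewrite -/D !ler_norml expr1n => /andP[? ?] /andP[? ?]; lra.
- move=> m' mt' Cm' Cmt'.
  by apply: (functional_diffpC (DF_functional _ (CB _ Cm')));
    apply: (CB _ _).1.
- move=> i m' mt' Cm' Cmt'.
  by apply: (functional_diffpC (DG_functional i _ (CB _ Cm')));
    apply: (CB _ _).1.
- by rewrite mulr_ge0 ?sqr_ge0// ltW.
- by rewrite mulr_ge0// ltW.
Qed.
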